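(* Let $G$ be a compact Lie group and $X$ a compact $G$-ANR. Then $$TC_G(X)={}_{\Delta(X)}\mathrm{cat}_G^{Wh}(X\times X),$$ where $X\times X$ carries the diagonal $G$-action. In particular, for the classical topological complexity (of a compact ANR $X$, with trivial group), $$TC(X)={}_{\Delta(X)}\mathrm{cat}(X\times X)={}_{\Delta(X)}\mathrm{cat}^{Wh}(X\times X).$$ Moreover, if $\daleth(X)\subseteq X\times X$ is a closed $G\times G$-cofibration, then $$TC^G(X)={}_{\daleth(X)}\mathrm{cat}_{G\times G}(X\times X)={}_{\daleth(X)}\mathrm{cat}_{G\times G}^{Wh}(X\times X).$$
   Context: A $G$-ANR is a metrizable $G$-space which is an equivariant neighbourhood retract of every metrizable $G$-space containing it as a closed $G$-invariant subspace. For a group $K$, a $K$-space $Z$ and a closed $K$-invariant subset $A\subseteq Z$, an open $K$-invariant subset $U\subseteq Z$ is $K$-compressible into $A$ if the inclusion $U\subseteq Z$ is $K$-homotopic (as maps $U\to Z$) to a $K$-map $c\colon U\to Z$ with $c(U)\subseteq A$. ${}_A\mathrm{cat}_K(Z)$ is the least $n$ such that $Z$ is covered by $n$ open $K$-invariant subsets, each $K$-compressible into $A$ ($\infty$ if none). $A\subseteq Z$ is a closed $K$-cofibration if $A$ is closed and $K$-invariant and the pair has the $K$-equivariant homotopy extension property for maps into all $K$-spaces. In that case the fat $A$-sum $F^n_A(Z)\subseteq Z^n$ is defined by $F^1_A(Z)=A$ and $F^n_A(Z)$ is the pushout, in $K$-spaces, of $A\times Z^{n-1}\leftarrow A\times F^{n-1}_A(Z)\to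 Z\times F^{n-1}_A(Z)$ (maps induced by inclusions), with its canonical map to $Z^n$. The Whitehead category satisfies ${}_A\mathrm{cat}^{Wh}_K(Z)\le n$ if and only if there is a $K$-map $\xi_n\colon Z\to F^n_A(Z)$ whose composition with $F^n_A(Z)\subseteq Z^n$ is $K$-homotopic to the diagonal $\Delta_n\colon Z\to Z^n$. When the group is trivial it is dropped from the notation. $\Delta(X)\subseteq X\times X$ is the diagonal; with the $G\times G$-action $(g_1,g_2)(x_1,x_2)=(g_1x_1,g_2x_2)$ on $X\times X$, $\daleth(X):=(G\times G)\cdot\Delta(X)$, and $TC^G(X):={}_{\daleth(X)}\mathrm{cat}_{G\times G}(X\times X)$. $TC_G(X)$ is the least $n$ such that $X\times X$ (with diagonal $G$-action) is covered by $n$ open $G$-invariant sets $U_i$, each admitting a $G$-map $s_i\colon U_i\to PX$ with $\pi\circ s_i$ equal to the inclusion, where $PX$ is the space of paths $[0,1]\to X$ with pointwise $G$-action and $\pi(\gamma)=(\gamma(0),\gamma(1))$; $TC(X)$ is the case of the trivial group. *)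

(* Defs.v *)
From HB Require Import structures.
From Stdlib Require Import Relation_Operators.
From mathcomp Require Import all_boot all_order all_algebra generic_quotient.
From mathcomp Require Import all_classical all_reals all_analysis.
Import numFieldNormedType.Exports.

Set Implicit Arguments.
Unset Strict Implicit.
Unset Printing Implicit Defensive.

Import Order.TTheory GRing.Theory Num.Theory.

Local Open Scope classical_set_scope.
Local Open Scope ring_scope.

Lemma continuous_compose (X Y Z : topologicalType) (f : X -> Y) (g : Y -> Z) :
  continuous f -> continuous g -> continuous (fun x => g (f x)).
Proof. by move=> cf cg x; apply: continuous_comp; [exact: cf|exact: cg]. Qed.

Lemma continuous_pair (X Y Z : topologicalType) (f : X -> Y) (g : X -> Z) :
  continuous f -> continuous g -> continuous (fun x => (f x, g x)).
Proof. by move=> cf cg x; apply: cvg_pair; [exact: cf|exact: cg]. Qed.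

Lemma continuous_fst (X Y : topologicalType) : continuous (@fst X Y).
Proof. by move=> x; exact: cvg_fst. Qed.

Lemma continuous_snd (X Y : topologicalType) : continuous (@snd X Y).
Proof. by move=> x; exact: cvg_snd. Qed.

Lemma continuous_id (X : topologicalType) : continuous (fun x : X => x).
Proof. by move=> x. Qed.

Lemma continuous_const (X Y : topologicalType) (y : Y) :
  continuous (fun _ : X => y).
Proof. by move=> x; exact: cvg_cst. Qed.

Ltac cts := repeat first
  [ assumption
  | apply: continuous_pair
  | exact: continuous_fst
  | exact: continuous_snd
  | exact: continuous_id
  | apply: (continuous_compose (f := fst)) => //; exact: continuous_fst
  | apply: (continuous_compose (f := snd)) => //; exact: continuous_snd ].

HB.mixin Record isTopologicalGroup G & Group G & Topological G := {
  mulg_continuous : continuous (fun p : G * G => (p.1 * p.2)%g);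
  invg_continuous : continuous (fun g : G => (g^-1)%g)
}.

#[short(type="topGroupType")]
HB.structure Definition TopGroup :=
  {G of isTopologicalGroup G & Group G & Topological G}.

HB.mixin Record isCompactHausdorff T & Topological T := {
  compactT : compact [set: T];
  hausdorffT : hausdorff_space T
}.

#[short(type="compactGroupType")]
HB.structure Definition CompactGroup :=
  {G of isCompactHausdorff G & TopGroup G}.

Section prod_group.

Lemma prod_mulg_continuous (G H : topGroupType) :
  continuous (fun p : (G * H) * (G * H) => (p.1 * p.2)%g).
Proof.
apply: (@continuous_pair _ _ _
  (fun p : (G * H) * (G * H) => (p.1.1 * p.2.1)%g)
  (fun p : (G * H) * (G * H) => (p.1.2 * p.2.2)%g)).
- apply: (@continuous_compose _ _ _
    (fun p : (G * H) * (G * H) => (p.1.1, p.2.1)) (fun p => (p.1 * p.2)%g));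
    last exact: mulg_continuous.
  by apply: continuous_pair;
    [apply: (@continuous_compose _ _ _ fst fst)
    |apply: (@continuous_compose _ _ _ snd fst)]; cts.
- apply: (@continuous_compose _ _ _
    (fun p : (G * H) * (G * H) => (p.1.2, p.2.2)) (fun p => (p.1 * p.2)%g));
    last exact: mulg_continuous.
  by apply: continuous_pair;
    [apply: (@continuous_compose _ _ _ fst snd)
    |apply: (@continuous_compose _ _ _ snd snd)]; cts.
Qed.

Lemma prod_invg_continuous (G H : topGroupType) :
  continuous (fun p : G * H => (p^-1)%g).
Proof.
apply: (@continuous_pair _ _ _ (fun p : G * H => (p.1^-1)%g)
  (fun p : G * H => (p.2^-1)%g)).
- by apply: (@continuous_compose _ _ _ fst (fun g : G => g^-1%g)); cts;
    exact: invg_continuous.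
- by apply: (@continuous_compose _ _ _ snd (fun g : H => g^-1%g)); cts;
    exact: invg_continuous.
Qed.

HB.instance Definition _ (G H : topGroupType) :=
  isTopologicalGroup.Build (G * H)%type
    (@prod_mulg_continuous G H) (@prod_invg_continuous G H).

Lemma prod_compactT (G H : compactGroupType) : compact [set: G * H].
Proof. by rewrite -setXTT; apply: compact_setX; exact: compactT. Qed.

Lemma prod_hausdorffT (G H : compactGroupType) : hausdorff_space (G * H)%type.
Proof.
move=> [g h] [g' h'] c; congr pair.
- apply: hausdorffT => A B nA nB.
  have [||[x y] /= [Ax Bx]] := c (A `*` setT) (B `*` setT).
  + by exists (A, setT) => //; split => //; exact: filterT.
  + by exists (B, setT) => //; split => //; exact: filterT.
  + by exists x; split; [case: Ax|case: Bx].
- apply: hausdorffT => A B nA nB.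
  have [||[x y] /= [Ax Bx]] := c (setT `*` A) (setT `*` B).
  + by exists (setT, A) => //; split => //; exact: filterT.
  + by exists (setT, B) => //; split => //; exact: filterT.
  + by exists y; split; [case: Ax|case: Bx].
Qed.

HB.instance Definition _ (G H : compactGroupType) :=
  isCompactHausdorff.Build (G * H)%type
    (@prod_compactT G H) (@prod_hausdorffT G H).

End prod_group.

Section unit_group.

Let mulu (_ _ : unit) := tt.
Fact unit_mulA : associative mulu. Proof. by []. Qed.
Fact unit_mul1 : left_id tt mulu. Proof. by case. Qed.
Fact unit_mulr1 : right_id tt mulu. Proof. by case. Qed.
Fact unit_mulV : left_inverse tt id mulu. Proof. by []. Qed.
Fact unit_mulrV : right_inverse tt id mulu. Proof. by []. Qed.
HB.instance Definition _ :=
  isGroup.Build unit unit_mulA unit_mul1 unit_mulr1 unit_mulV unit_mulrV.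

HB.instance Definition _ := hasNbhs.Build unit principal_filter.
HB.instance Definition _ := Discrete_ofNbhs.Build unit erefl.

Fact unit_mulg_continuous : continuous (fun p : unit * unit => (p.1 * p.2)%g).
Proof. by move=> p; exact: cvg_cst. Qed.
Fact unit_invg_continuous : continuous (fun g : unit => (g^-1)%g).
Proof. exact: continuous_id. Qed.
HB.instance Definition _ :=
  isTopologicalGroup.Build unit unit_mulg_continuous unit_invg_continuous.

Fact unit_compactT : compact [set: unit].
Proof. by apply: finite_compact; exact: finite_finset. Qed.
Fact unit_hausdorffT : hausdorff_space unit.
Proof. by move=> [] []. Qed.
HB.instance Definition _ :=
  isCompactHausdorff.Build unit unit_compactT unit_hausdorffT.

End unit_group.

Record gspace (K : topGroupType) := GSpace {
  gcarrier :> topologicalType;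
  gact : K -> gcarrier -> gcarrier;
  gact1 : forall x, gact 1%g x = x;
  gactM : forall g h x, gact (g * h)%g x = gact g (gact h x);
  gact_continuous : continuous (fun p : K * gcarrier => gact p.1 p.2)
}.

Record gmap (K : topGroupType) (X Y : gspace K) := GMap {
  gfun :> X -> Y;
  gfun_continuous : continuous gfun;
  gfun_equivariant : forall g x, gfun (gact g x) = gact g (gfun x)
}.

Section gspace_constructions.
Context {K : topGroupType}.
Implicit Types X Y Z : gspace K.

Definition gmap_id X : gmap X X :=
  GMap (@continuous_id X) (fun _ _ => erefl).

Program Definition gmap_comp X Y Z (f : gmap Y Z) (h : gmap X Y) : gmap X Z :=
  @GMap K X Z (fun x => f (h x)) _ _.
Next Obligation.
by move=> *; apply: continuous_compose; exact: gfun_continuous.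
Qed.
Next Obligation. by move=> * /=; rewrite !gfun_equivariant. Qed.

Program Definition gtriv (T : topologicalType) : gspace K :=
  @GSpace K T (fun _ x => x) _ _ _.
Next Obligation. by []. Qed.
Next Obligation. by []. Qed.
Next Obligation. by move=> T; exact: continuous_snd. Qed.

Program Definition gprod X Y : gspace K :=
  @GSpace K (X * Y)%type (fun g p => (gact g p.1, gact g p.2)) _ _ _.
Next Obligation. by move=> X Y [x y] /=; rewrite !gact1. Qed.
Next Obligation. by move=> X Y g h [x y] /=; rewrite !gactM. Qed.
Next Obligation.
move=> X Y; apply: continuous_pair.
- apply: (@continuous_compose _ _ _ (fun p : K * (X * Y) => (p.1, p.2.1))
    (fun q => gact q.1 q.2)); last exact: gact_continuous.
  by apply: continuous_pair; [|apply: (@continuous_compose _ _ _ snd fst)]; cts.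
- apply: (@continuous_compose _ _ _ (fun p : K * (X * Y) => (p.1, p.2.2))
    (fun q => gact q.1 q.2)); last exact: gact_continuous.
  by apply: continuous_pair; [|apply: (@continuous_compose _ _ _ snd snd)]; cts.
Qed.

Program Definition gmap_pair X Y Z (f : gmap X Y) (h : gmap X Z) :
    gmap X (gprod Y Z) :=
  @GMap K X (gprod Y Z) (fun x => (f x, h x)) _ _.
Next Obligation.
by move=> *; apply: continuous_pair; exact: gfun_continuous.
Qed.
Next Obligation. by move=> * /=; rewrite !gfun_equivariant. Qed.

Program Definition gmap_prod X Y X' Y' (f : gmap X X') (h : gmap Y Y') :
    gmap (gprod X Y) (gprod X' Y') :=
  @GMap K (gprod X Y) (gprod X' Y') (fun p => (f p.1, h p.2)) _ _.
Next Obligation.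
move=> X Y X' Y' f h; apply: continuous_pair.
- by apply: (@continuous_compose _ _ _ fst f); cts; exact: gfun_continuous.
- by apply: (@continuous_compose _ _ _ snd h); cts; exact: gfun_continuous.
Qed.
Next Obligation. by move=> *; rewrite /= !gfun_equivariant. Qed.

Definition ginvariant Z (A : set Z) := forall g z, A z -> A (gact g z).

Section subspace.
Variables (Z : gspace K) (A : set Z) (hA : ginvariant A).

Definition gsub_act (g : K) (a : set_type A) : set_type A :=
  exist _ (gact g (val a)) (mem_set (hA g (set_mem (valP a)))).

Lemma gsub_act1 a : gsub_act 1%g a = a.
Proof. by apply: val_inj; rewrite /= gact1. Qed.

Lemma gsub_actM g h a : gsub_act (g * h)%g a = gsub_act g (gsub_act h a).
Proof. by apply: val_inj; rewrite /= gactM. Qed.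

Lemma continuous_val : continuous (val : set_type A -> Z).
Proof. exact: (@initial_continuous (set_type A) Z val). Qed.

Lemma continuous_to_sub (T : topologicalType) (f : T -> set_type A) :
  continuous (fun t => val (f t)) -> continuous f.
Proof.
move=> cf; apply/continuousP => _ [B oB <-].
by move/continuousP: cf => /(_ _ oB).
Qed.

Lemma gsub_act_continuous :
  continuous (fun p : K * set_type A => gsub_act p.1 p.2).
Proof.
apply: continuous_to_sub.
apply: (@continuous_compose _ _ _ (fun p : K * set_type A => (p.1, val p.2))
    (fun q => gact q.1 q.2)); last exact: gact_continuous.
apply: continuous_pair; first by cts.
by apply: (@continuous_compose _ (set_type A) Z snd val); cts; exact: continuous_val.
Qed.

Definition gsub : gspace K :=
  GSpace gsub_act1 gsub_actM gsub_act_continuous.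

Definition gincl : gmap gsub Z :=
  @GMap K gsub Z val continuous_val (fun _ _ => erefl).

End subspace.

End gspace_constructions.

(* The pushout of [X <- C -> Y] is the quotient of the disjoint union of [X] and
[Y] by the equivalence relation generated by [f c ~ h c], with the final
topology for the two canonical maps. Compactness of [K] makes the induced
action jointly continuous, so this is also the pushout among K-spaces. *)

Section pushout.
Local Open Scope quotient_scope.
Context {K : compactGroupType} {C X Y : gspace K}.
Variables (f : gmap C X) (h : gmap C Y).

Inductive po_step : X + Y -> X + Y -> Prop :=
  | PoStep c : po_step (inl (f c)) (inr (h c)).

Definition po_rel (a b : X + Y) := `[< clos_refl_sym_trans _ po_step a b >].

Lemma po_rel_refl : reflexive po_rel.
Proof. by move=> a; apply/asboolP; exact: rst_refl. Qed.

Lemma po_rel_sym : symmetric po_rel.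
Proof.
by move=> a b; apply/idP/idP => /asboolP ab; apply/asboolP; exact: rst_sym.
Qed.

Lemma po_rel_trans : transitive po_rel.
Proof.
move=> b a c /asboolP ab /asboolP bc; apply/asboolP.
exact: rst_trans bc.
Qed.

Definition po_equiv := EquivRel po_rel po_rel_refl po_rel_sym po_rel_trans.

Definition po_type : Type := {eq_quot po_equiv}.
HB.instance Definition _ := Choice.on po_type.
HB.instance Definition _ := EqQuotient.on po_type.

Definition po_inl_fun (x : X) : po_type := \pi_po_type%qT (inl x).
Definition po_inr_fun (y : Y) : po_type := \pi_po_type%qT (inr y).

Definition po_open : set (set po_type) :=
  [set U | open (po_inl_fun @^-1` U) /\ open (po_inr_fun @^-1` U)].

Lemma po_openT : po_open setT.
Proof. by split; rewrite preimage_setT; exact: openT. Qed.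

Lemma po_openI A B : po_open A -> po_open B -> po_open (A `&` B).
Proof. by move=> [? ?] [? ?]; split; rewrite preimage_setI; exact: openI. Qed.

Lemma po_open_bigU (I : Type) (F : I -> set po_type) :
  (forall i, po_open (F i)) -> po_open (\bigcup_i F i).
Proof.
by move=> oF; split; rewrite preimage_bigcup; apply: bigcup_open => i _;
  case: (oF i).
Qed.

HB.instance Definition _ :=
  isOpenTopological.Build po_type po_openT po_openI po_open_bigU.

Lemma po_openE (U : set po_type) : open U = po_open U.
Proof. by []. Qed.

Lemma po_inl_continuous : continuous po_inl_fun.
Proof. by apply/continuousP => U; rewrite po_openE => -[]. Qed.

Lemma po_inr_continuous : continuous po_inr_fun.
Proof. by apply/continuousP => U; rewrite po_openE => -[]. Qed.

Lemma po_glue c : po_inl_fun (f c) = po_inr_fun (h c).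
Proof.
rewrite /po_inl_fun /po_inr_fun; apply/(@eqquotP _ po_equiv po_type).
by apply/asboolP; exact: rst_step.
Qed.

Lemma po_ind (P : po_type -> Prop) :
  (forall x, P (po_inl_fun x)) -> (forall y, P (po_inr_fun y)) ->
  forall q, P q.
Proof. by move=> Pl Pr q; rewrite -[q]reprK; case: (repr q). Qed.

Section descent.
Variables (T : Type) (u : X -> T) (v : Y -> T).
Hypothesis uv : forall c, u (f c) = v (h c).

Definition po_desc (q : po_type) : T :=
  match repr q with inl x => u x | inr y => v y end.

Let desc (a : X + Y) := match a with inl x => u x | inr y => v y end.

Lemma po_desc_pi a : po_desc (\pi_po_type%qT a) = desc a.
Proof.
have E b c : clos_refl_sym_trans _ po_step b c -> desc b = desc c.
  by elim=> [_ _ [d]|//|? ? _ <-|? ? ? _ -> _ ->] //=.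
by apply: E; apply/asboolP/(@eqquotP _ po_equiv po_type); rewrite reprK.
Qed.

Lemma po_desc_inl x : po_desc (po_inl_fun x) = u x.
Proof. exact: po_desc_pi. Qed.

Lemma po_desc_inr y : po_desc (po_inr_fun y) = v y.
Proof. exact: po_desc_pi. Qed.

End descent.

Definition po_act (g : K) : po_type -> po_type :=
  po_desc (fun x => po_inl_fun (gact g x)) (fun y => po_inr_fun (gact g y)).

Lemma po_act_inl g x : po_act g (po_inl_fun x) = po_inl_fun (gact g x).
Proof.
by rewrite /po_act po_desc_inl// => c; rewrite -!gfun_equivariant po_glue.
Qed.

Lemma po_act_inr g y : po_act g (po_inr_fun y) = po_inr_fun (gact g y).
Proof.
by rewrite /po_act po_desc_inr// => c; rewrite -!gfun_equivariant po_glue.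
Qed.

Lemma po_act1 q : po_act 1%g q = q.
Proof.
by elim/po_ind: q => z; rewrite (po_act_inl, po_act_inr) gact1.
Qed.

Lemma po_actM g k q : po_act (g * k)%g q = po_act g (po_act k q).
Proof.
by elim/po_ind: q => z; rewrite !(po_act_inl, po_act_inr) gactM.
Qed.

Lemma po_tube (Z : gspace K) (i : Z -> po_type) (N : set K) (W : set po_type) :
  continuous i -> (forall g z, po_act g (i z) = i (gact g z)) ->
  compact N -> open W ->
  open (i @^-1` [set q | forall g, N g -> W (po_act g q)]).
Proof.
move=> ci iE cN oW.
rewrite (_ : _ @^-1` _ = [set z | forall g, N g -> W (i (gact g z))]); last first.
  by apply/seteqP; split => z /= zW g /zW; rewrite iE.
rewrite openE => z /= zW; rewrite /interior.
move/compact_near_coveringP : cN.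
move=> /(_ _ (nbhs z) (fun z g => W (i (gact g z))) _); apply => g Ng.
have ciact : continuous (fun p : K * Z => i (gact p.1 p.2)).
  by apply: (@continuous_compose _ _ _ (fun p : K * Z => gact p.1 p.2) i) => //;
    exact: gact_continuous.
by apply: (ciact (g, z)); apply: open_nbhs_nbhs; split => //; exact: zW.
Qed.

Lemma po_act_continuous : continuous (fun p : K * po_type => po_act p.1 p.2).
Proof.
move=> [g q] /= A; rewrite nbhsE => -[W [oW Wgq] WA].
have corb : continuous (fun k => po_act k q).
  elim/po_ind: q {Wgq} => z.
  - rewrite (_ : (fun k => _) = (fun k => po_inl_fun (gact k z))); last first.
      by apply/funext => k; rewrite po_act_inl.
    apply: (@continuous_compose _ _ _ (fun k => gact k z)); last first.
      exact: po_inl_continuous.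
    apply: (@continuous_compose _ _ _ (fun k : K => (k, z))
      (fun p => gact p.1 p.2)); last exact: gact_continuous.
    by apply: continuous_pair; [exact: continuous_id|exact: continuous_const].
  - rewrite (_ : (fun k => _) = (fun k => po_inr_fun (gact k z))); last first.
      by apply/funext => k; rewrite po_act_inr.
    apply: (@continuous_compose _ _ _ (fun k => gact k z)); last first.
      exact: po_inr_continuous.
    apply: (@continuous_compose _ _ _ (fun k : K => (k, z))
      (fun p => gact p.1 p.2)); last exact: gact_continuous.
    by apply: continuous_pair; [exact: continuous_id|exact: continuous_const].
have gN : nbhs g ((fun k => po_act k q) @^-1` W).
  by apply: corb; exact: open_nbhs_nbhs.
have [N nN clN] := compact_regular hausdorffT compactT filterT gN.
pose V := [set p : po_type | forall k, closure N k -> W (po_act k p)].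
have cN : compact (closure N).
  by apply: (subclosed_compact _ compactT) => //; exact: closed_closure.
exists (N, V) => /=; last first.
  by move=> [k p] [/= Nk Vp]; apply/WA/Vp; exact: subset_closure.
split => //; apply: open_nbhs_nbhs; split; last by move=> k /clN.
rewrite po_openE; split.
- by apply: po_tube => //; [exact: po_inl_continuous|exact: po_act_inl].
- by apply: po_tube => //; [exact: po_inr_continuous|exact: po_act_inr].
Qed.

Definition pushout : gspace K := GSpace po_act1 po_actM po_act_continuous.

Definition po_inl : gmap X pushout :=
  @GMap K X pushout po_inl_fun po_inl_continuous
    (fun g x => esym (po_act_inl g x)).

Definition po_inr : gmap Y pushout :=
  @GMap K Y pushout po_inr_fun po_inr_continuous
    (fun g y => esym (po_act_inr g y)).

Section universal_map.
Variables (Z : gspace K) (u : gmap X Z) (v : gmap Y Z).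
Hypothesis uv : forall c, u (f c) = v (h c).

Lemma po_desc_continuous : continuous (po_desc u v : pushout -> Z).
Proof.
apply/continuousP => U oU; rewrite po_openE; split.
- rewrite (_ : _ @^-1` _ = u @^-1` U); last first.
    by apply/seteqP; split => x /=; rewrite po_desc_inl.
  by have /continuousP := @gfun_continuous _ _ _ u; exact.
- rewrite (_ : _ @^-1` _ = v @^-1` U); last first.
    by apply/seteqP; split => x /=; rewrite po_desc_inr.
  by have /continuousP := @gfun_continuous _ _ _ v; exact.
Qed.

Lemma po_desc_equivariant g (q : pushout) :
  po_desc u v (gact g q) = gact g (po_desc u v q).
Proof.
elim/po_ind: q => z /=.
- by rewrite po_act_inl !po_desc_inl// gfun_equivariant.
- by rewrite po_act_inr !po_desc_inr// gfun_equivariant.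
Qed.

Definition po_map : gmap pushout Z :=
  GMap po_desc_continuous po_desc_equivariant.

End universal_map.

End pushout.

Definition unit_interval (R : realType) : topologicalType :=
  set_type (`[0, 1]%classic : set R).

Fact itv01_0 (R : realType) : (0 : R) \in (`[0, 1]%classic : set R).
Proof. by apply/mem_set; rewrite /= in_itv /= lexx ler01. Qed.

Fact itv01_1 (R : realType) : (1 : R) \in (`[0, 1]%classic : set R).
Proof. by apply/mem_set; rewrite /= in_itv /= lexx ler01. Qed.

Definition I0 {R : realType} : unit_interval R := exist _ 0 (itv01_0 R).
Definition I1 {R : realType} : unit_interval R := exist _ 1 (itv01_1 R).

Section homotopy.
Variable R : realType.
Context {K : topGroupType}.

Definition cylinder (Y : gspace K) : gspace K :=
  gprod Y (gtriv (unit_interval R)).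

Definition ghomotopic (Y Z : gspace K) (f h : gmap Y Z) :=
  exists H : gmap (cylinder Y) Z,
    forall y, H (y, I0) = f y /\ H (y, I1) = h y.

Definition closed_cofibration (Z : gspace K) (A : set Z)
    (hA : ginvariant A) :=
  closed A /\
  forall (Y : gspace K) (f : gmap Z Y) (H : gmap (cylinder (gsub hA)) Y),
    (forall a, H (a, I0) = f (gincl hA a)) ->
    exists E : gmap (cylinder Z) Y,
      (forall z, E (z, I0) = f z) /\
      (forall a t, E (gincl hA a, t) = H (a, t)).

End homotopy.

Definition metrizable (R : realType) (T : topologicalType) :=
  exists d : T -> T -> R,
    [/\ forall x y, d x y = 0 <-> x = y,
        forall x y, d x y = d y x,
        forall x y z, d x z <= d x y + d y z &
        forall x, nbhs x = nbhs_ball_ (fun x e => [set y | d x y < e]) x].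

Definition closed_embedding (S T : topologicalType) (i : S -> T) :=
  [/\ injective i, closed (range i) &
      forall V : set S, open V <-> exists2 W, open W & V = i @^-1` W].

Definition ganr (R : realType) (K : topGroupType) (X : gspace K) :=
  metrizable R X /\
  forall (Y : gspace K) (i : gmap X Y),
    metrizable R Y -> closed_embedding i ->
    exists (U : set Y) (hU : ginvariant U),
      [/\ open U, range i `<=` U &
          exists r : gmap (gsub hU) X,
            forall u x, gincl hU u = i x -> r u = x].

(* [None] stands for infinity. *)
Definition least (P : nat -> Prop) : option nat :=
  match pselect (exists n, `[< P n >]) with
  | left e => Some (ex_minn e)
  | right _ => None
  end.

Section gcat.
Variable R : realType.
Context {K : topGroupType}.
Variables (Z : gspace K) (A : set Z).

Definition compressible (U : set Z) (hU : ginvariant U) :=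
  exists2 c : gmap (gsub hU) Z,
    range c `<=` A & ghomotopic R (gincl hU) c.

Definition gcat_le (n : nat) :=
  exists U : 'I_n -> set Z,
    (forall i, open (U i) /\
       exists hU : ginvariant (U i), compressible hU) /\
    \bigcup_i U i = setT.

Definition gcat := least gcat_le.

End gcat.

Section fat_sum.
Variable R : realType.
Context {K : compactGroupType}.
Variable Z : gspace K.

(* [gpowS m] is the power Z^(m+1), as a right-nested product. *)
Fixpoint gpowS (m : nat) : gspace K :=
  if m is m'.+1 then gprod Z (gpowS m') else Z.

Fixpoint gdiagS (m : nat) : gmap Z (gpowS m) :=
  if m is m'.+1 then gmap_pair (gmap_id Z) (gdiagS m') else gmap_id Z.

Variables (A : set Z) (hA : ginvariant A).
Let As := gsub hA.
Let iA : gmap As Z := gincl hA.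

(* [fat_sumS m] is the fat sum F^(m+1), paired with its map to Z^(m+1). *)
Fixpoint fat_sumS (m : nat) : {F : gspace K & gmap F (gpowS m)} :=
  match m with
  | 0 => existT (fun F => gmap F (gpowS 0)) As iA
  | m'.+1 =>
    let: existT F j := fat_sumS m' in
    existT (fun F => gmap F (gpowS m'.+1))
      (pushout (gmap_prod (gmap_id As) j) (gmap_prod iA (gmap_id F)))
      (@po_map _ _ _ _ (gmap_prod (gmap_id As) j) (gmap_prod iA (gmap_id F))
         (gprod Z (gpowS m'))
         (gmap_prod iA (gmap_id (gpowS m'))) (gmap_prod (gmap_id Z) j)
         (fun _ => erefl))
  end.

(* F^0 is read as the empty space, so the bound 0 holds only for empty Z;
   this matches the empty cover in [gcat_le]. *)
Definition gcatWh_le (n : nat) :=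
  if n is m.+1 then
    exists xi : gmap Z (projT1 (fat_sumS m)),
      ghomotopic R (gmap_comp (projT2 (fat_sumS m)) xi) (gdiagS m)
  else ~ exists z : Z, True.

Definition gcatWh := least gcatWh_le.

End fat_sum.

Lemma diagonal_invariant (K : topGroupType) (X : gspace K) :
  ginvariant (diagonal : set (gprod X X)).
Proof. by move=> g [x y]; rewrite /diagonal /= => ->. Qed.
Arguments diagonal_invariant {K} X.

Program Definition gsquare (K : topGroupType) (X : gspace K) :
    gspace (K * K)%type :=
  @GSpace (K * K)%type (X * X)%type
    (fun g p => (gact g.1 p.1, gact g.2 p.2)) _ _ _.
Next Obligation. by move=> K X [x y] /=; rewrite !gact1. Qed.
Next Obligation. by move=> K X [g h] [g' h'] [x y] /=; rewrite !gactM. Qed.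
Next Obligation.
move=> K X; apply: continuous_pair.
- apply: (@continuous_compose _ _ _
    (fun p : (K * K) * (X * X) => (p.1.1, p.2.1)) (fun q => gact q.1 q.2));
    last exact: gact_continuous.
  by apply: continuous_pair; [apply: (@continuous_compose _ _ _ fst fst)|
    apply: (@continuous_compose _ _ _ snd fst)]; cts.
- apply: (@continuous_compose _ _ _
    (fun p : (K * K) * (X * X) => (p.1.2, p.2.2)) (fun q => gact q.1 q.2));
    last exact: gact_continuous.
  by apply: continuous_pair; [apply: (@continuous_compose _ _ _ fst snd)|
    apply: (@continuous_compose _ _ _ snd snd)]; cts.
Qed.

Definition daleth (K : topGroupType) (X : gspace K) : set (gsquare X) :=
  [set p | exists g : K * K, exists2 q : gsquare X, diagonal q & p = gact g q].
Arguments daleth {K} X.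

Lemma daleth_invariant (K : topGroupType) (X : gspace K) :
  ginvariant (daleth X).
Proof.
move=> g _ [h [q dq ->]]; exists (g * h)%g; exists q => //.
by rewrite gactM.
Qed.
Arguments daleth_invariant {K} X.

Definition path_space (R : realType) (X : topologicalType) : topologicalType :=
  initial_topology (fun gamma : continuousType (unit_interval R) X =>
    (gamma : {compact-open, unit_interval R -> X})).

Section TC.
Variable R : realType.

Definition path_fun (X : topologicalType) (gamma : path_space R X) :
    continuousType (unit_interval R) X := gamma.

Fact path_act_continuous (K : topGroupType) (X : gspace K) (g : K)
  (gamma : path_space R X) : continuous (fun t => gact g (path_fun gamma t)).
Proof.
apply: (@continuous_compose _ _ _ (fun t => (g, path_fun gamma t))
  (fun p => gact p.1 p.2)); last exact: gact_continuous.
apply: continuous_pair; first exact: (@continuous_const _ K g).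
by move=> t; exact: (@cts_fun _ _ (path_fun gamma)).
Qed.

Definition path_act (K : topGroupType) (X : gspace K) (g : K)
    (gamma : path_space R X) : path_space R X :=
  (mkcts (@path_act_continuous K X g gamma)
     : continuousType (unit_interval R) X).

Definition TC_sub_le (K : topGroupType) (X : gspace K) (n : nat) :=
  exists U : 'I_n -> set (gprod X X),
    (forall i, open (U i) /\
       exists (hU : ginvariant (U i)) (s : gsub hU -> path_space R X),
         [/\ continuous s,
             forall g u, s (gact g u) = path_act g (s u) &
             forall u, (path_fun (s u) I0, path_fun (s u) I1) = gincl hU u]) /\
    \bigcup_i U i = setT.

(* [TC_sub], [TC_sup] and [TC] are TC_G(X), TC^G(X) and TC(X). *)
Definition TC_sub (K : topGroupType) (X : gspace K) := least (TC_sub_le X).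

Definition TC_sup (K : topGroupType) (X : gspace K) := gcat R (daleth X).

Definition TC (X : topologicalType) := TC_sub (@gtriv unit X).

End TC.

Section smooth.
Context {R : realType}.

Section Ck.
Context {m : nat}.

Fixpoint Ck (k : nat) (D : set 'rV[R]_m) (f : 'rV[R]_m -> R) : Prop :=
  {within D, continuous f} /\
  if k is k'.+1 then
    forall i : 'I_m, (forall x, D x -> derivable f x (delta_mx 0 i)) /\
      Ck k' D (fun x => 'D_(delta_mx 0 i) f x)
  else True.

End Ck.

Definition smooth (m p : nat) (D : set 'rV[R]_m) (f : 'rV[R]_m -> 'rV[R]_p) :=
  forall k j, Ck k D (fun x => f x 0 j).

(* [phi] and [psi] are mutually inverse homeomorphisms between the open sets
   [U] and [phi @` U]. *)
Definition chart (T : topologicalType) (n : nat) (U : set T)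
    (phi : T -> 'rV[R]_n) (psi : 'rV[R]_n -> T) :=
  [/\ open U, open (phi @` U), {within U, continuous phi},
      {within phi @` U, continuous psi} & forall x, U x -> psi (phi x) = x].

End smooth.

(* Hausdorffness and second countability are not asked for: this is only used
   for compact Hausdorff groups. *)
Definition lie_group (R : realType) (G : topGroupType) :=
  exists (n : nat) (I : Type) (U : I -> set G)
    (phi : I -> G -> 'rV[R]_n) (psi : I -> 'rV[R]_n -> G),
  [/\ (forall i, chart (U i) (phi i) (psi i)) /\ \bigcup_i U i = setT,
      forall i j,
        smooth (phi i @` (U i `&` U j)) (fun x => phi j (psi i x)),
      forall i j k,
        smooth [set z : 'rV[R]_(n + n) |
            [/\ (phi i @` U i) (lsubmx z), (phi j @` U j) (rsubmx z) &
                U k (psi i (lsubmx z) * psi j (rsubmx z))%g]]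
          (fun z => phi k (psi i (lsubmx z) * psi j (rsubmx z))%g) &
      forall i j,
        smooth [set x | (phi i @` U i) x /\ U j ((psi i x)^-1)%g]
          (fun x => phi j ((psi i x)^-1)%g)].

(* Main.v *)
From HB Require Import structures.
Require Import Defs.
From mathcomp Require Import all_boot all_order all_algebra.
From mathcomp Require Import all_classical all_reals all_analysis.
From mathcomp Require Import ring lra.
Import numFieldNormedType.Exports.

(* Both [gcat] and [gcatWh] of [(Z, A)] are compared by means of an invariant
   open neighbourhood [N] of [A] which is compressible into [A].  A lift of the
   diagonal to the fat sum gives the cover by the preimages of [N] under its
   coordinates.  Conversely, the compressions of a cover are extended to
   self-maps of [Z] homotopic to the identity by cutting them off with invariant
   functions, and together these maps land in the fat sum, which for compact
   Hausdorff [Z] is embedded in the power of [Z].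

   For a cofibration [N] comes from homotopy extension.  For the diagonal of a
   compact G-ANR [X], embed [X] in the continuous functions on [G * X]: [N] is
   the set of pairs whose joining segment stays in a neighbourhood that retracts
   equivariantly onto [X].  Finally, a G-section of the path fibration over [U]
   is the same as a G-homotopy between the two projections of [U], which is the
   same as a compression of [U] into the diagonal. *)

Set Implicit Arguments.
Unset Strict Implicit.
Unset Printing Implicit Defensive.

Import Order.TTheory GRing.Theory Num.Theory.

Local Open Scope classical_set_scope.
Local Open Scope ring_scope.

(** * Sup norms over a compact set and their dependence on a parameter *)

Section sup_norm.
Context {R : realType} {W : topologicalType}.
Implicit Types (C : set W) (f g : W -> R) (e : R).

(** Bounds are taken nonnegative so that the norm over an empty [C] is 0. If [f] is unbounded on
    [C], this set is empty and its infimum is 0 by convention. *)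
Definition sup_bound C f : set R :=
  [set e | 0 <= e /\ forall w, C w -> `|f w| <= e].

Definition sup_norm C f : R := inf (sup_bound C f).

Lemma sup_norm_le C f e :
  0 <= e -> (forall w, C w -> `|f w| <= e) -> sup_norm C f <= e.
Proof. by move=> e0 fe; apply: ge_inf => //; exists 0 => x []. Qed.

Lemma sup_norm_ge0 C f : 0 <= sup_norm C f.
Proof.
have [[e Ee]|] := pselect (sup_bound C f !=set0).
  by apply: lb_le_inf; [exists e|move=> x []].
by move=> /set0P/negP/negPn/eqP; rewrite /sup_norm => ->; rewrite inf0.
Qed.

Lemma le_sup_norm C f w : compact C -> continuous f -> C w ->
  `|f w| <= sup_norm C f.
Proof.
move=> cC cf Cw; apply: lb_le_inf; last by move=> x [_]; exact.
have /compact_bounded [M [_ fM]] : compact (f @` C).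
  by apply: continuous_compact => //; exact: continuous_subspaceT.
have M1 : M < `|M| + 1 by rewrite (le_lt_trans (ler_norm M))// ltrDl.
exists (`|M| + 1); split=> [|x Cx]; first by rewrite addr_ge0.
by apply: (fM _ M1); exists x.
Qed.

Lemma sup_norm_leD C f g : compact C -> continuous f -> continuous g ->
  sup_norm C f <= sup_norm C g + sup_norm C (fun w => f w - g w).
Proof.
move=> cC cf cg; apply: sup_norm_le => [|w Cw].
  by rewrite addr_ge0// sup_norm_ge0.
have cfg : continuous (fun w => f w - g w).
  by move=> x; apply: cvgB; [exact: cf|exact: cg].
have h1 := le_sup_norm cC cg Cw; have h2 := le_sup_norm cC cfg Cw.
have := ler_normD (g w) (f w - g w); rewrite subrKC; lra.
Qed.

Lemma sup_norm_subC C f g :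
  sup_norm C (fun w => f w - g w) = sup_norm C (fun w => g w - f w).
Proof.
by congr inf; apply/seteqP; split=> e [e0 fe]; split=> // w /fe; rewrite distrC.
Qed.

(** Compactness leaves a uniform gap: some [d < e] still bounds [f] on all of [C]. *)
Lemma sup_norm_lt C f e : compact C -> continuous f -> 0 < e ->
  (forall w, C w -> `|f w| < e) -> sup_norm C f < e.
Proof.
move=> cC cf e0 fe.
have : \forall d \near e^'-, C `<=` (fun w => `|f w| <= d).
  move/compact_near_coveringP/near_covering_withinP : cC; apply => w Cw.
  (* The midpoint [m] separates the values of [f] near [w] from the [d] close to [e]. *)
  have lw := fe _ Cw; pose m := (`|f w| + e) / 2.
  near=> x d; suff : `|f x| <= d by []; apply: (@le_trans _ _ m).
    near: x.
    have : continuous (fun w => `|f w|).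
      by move=> y; apply: cvg_norm; exact: cf.
    move=> /(_ w); move/cvgr_le => /(_ m); apply.
    by rewrite /m midf_lt.
  apply: ltW; near: d; apply: nbhs_left_gt; rewrite /m midf_lt//.
move=> H.
have : \forall d \near e^'-, [/\ C `<=` (fun w => `|f w| <= d), 0 <= d & d < e].
  near=> d; split; [by near: d|near: d; exact: nbhs_left_ge|near: d].
  exact: nbhs_left_lt.
by move=> /filter_ex [d [Cd d0 /(le_lt_trans _)]]; apply; exact: sup_norm_le.
Unshelve. all: by end_near. Qed.

End sup_norm.

Section parametrized_sup_norm.
Context {R : realType} {T W : topologicalType}.
Variables (C : set W) (F : T * W -> R).
Hypotheses (cC : compact C) (cF : continuous F).

Lemma continuous_slice (t : T) : continuous (fun w => F (t, w)).
Proof.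
apply: (@continuous_compose _ _ _ (fun w => (t, w)) F) => //.
by apply: continuous_pair; [exact: continuous_const|exact: continuous_id].
Qed.

(** A tube argument: joint continuity gives the estimate near each [(t, w)], and compactness of [C]
    yields one neighbourhood of [t] that serves all [w]. *)
Lemma near_sup_norm (t : T) (e : R) : 0 < e ->
  \forall t' \near t, sup_norm C (fun w => F (t, w) - F (t', w)) <= e.
Proof.
move=> e0.
have H : \forall t' \near t, C `<=` (fun w => `|F (t, w) - F (t', w)| <= e).
  move/compact_near_coveringP : cC; apply => w Cw.
  have e2 : 0 < e / 2 by rewrite divr_gt0.
  have /cvgrPdist_le /(_ _ e2) := @cF (t, w).
  move=> [[A B] [/= At Bw] AB].
  exists (B, A) => // -[w' t'] /= [Bw' At'].
  have := AB (t, w') (conj (nbhs_singleton At) Bw').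
  have := AB (t', w') (conj At' Bw').
  rewrite /= => h1 h2; rewrite (splitr e).
  by rewrite (le_trans (ler_distD (F (t, w)) _ _))// lerD// distrC.
by apply: filterS H => t' H; apply: sup_norm_le => //; exact: ltW.
Qed.

Lemma sup_norm_continuous : continuous (fun t => sup_norm C (fun w => F (t, w))).
Proof.
move=> t; apply/cvgrPdist_le => e e0.
apply: filterS (near_sup_norm t e0) => t' le.
have c := continuous_slice.
have h1 := sup_norm_leD cC (c t) (c t').
have h2 := sup_norm_leD cC (c t') (c t).
rewrite -sup_norm_subC in h2.
by rewrite ler_norml; apply/andP; split; lra.
Qed.

End parametrized_sup_norm.

(** * The space of continuous real functions with the topology of uniform convergence *)

Definition sup_space (R : realType) (W : topologicalType) : Type :=
  continuousType W R.

Section sup_space.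
Context {R : realType} {W : topologicalType}.
Local Notation CW := (sup_space R W).

Definition sup_fun (f : CW) : W -> R := (f : continuousType W R).

Definition sup_mk (f : W -> R) (cf : continuous f) : CW :=
  (mkcts cf : continuousType W R).

Lemma sup_fun_continuous (f : CW) : continuous (sup_fun f).
Proof. exact: (@cts_fun _ _ (f : continuousType W R)). Qed.

Lemma sup_fun_inj : injective sup_fun.
Proof. by move=> f g fg; apply/continuousEP => x; move/(congr1 (@^~ x)): fg. Qed.

(** The pointwise form avoids [sup_norm], which is meaningful only for bounded functions. For
    compact [W], [sup_space_metrizable] shows that the sup distance has the same neighbourhoods. *)
Definition sup_ball (f : CW) (e : R) : set CW :=
  [set g | forall w, `|sup_fun f w - sup_fun g w| < e].

HB.instance Definition _ := Choice.on CW.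
HB.instance Definition _ := hasNbhs.Build CW (nbhs_ball_ sup_ball).

Fact sup_nbhs_filter (f : CW) : ProperFilter (nbhs f).
Proof.
apply: Build_ProperFilter_ex => [P [e /= e0 fP]|].
  by exists f; apply: fP => w; rewrite subrr normr0.
split=> [|P Q [e /= e0 fP] [d /= d0 fQ]|P Q PQ [e e0 fP]].
- by exists 1 => //=.
- exists (Num.min e d) => [|g fg]; first by rewrite /= lt_min e0 d0.
  by split; [apply: fP|apply: fQ] => w; have := fg w; rewrite lt_min => /andP[].
- by exists e => //; exact: subset_trans PQ.
Qed.

Fact sup_nbhs_singleton (f : CW) (P : set CW) : nbhs f P -> P f.
Proof. by move=> [e /= e0]; apply => w; rewrite subrr normr0. Qed.

Fact sup_nbhs_nbhs (f : CW) (P : set CW) : nbhs f P -> nbhs f (nbhs^~ P).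
Proof.
move=> [e /= e0 fP]; exists (e / 2) => [|g fg]; first by rewrite /= divr_gt0.
exists (e / 2) => [|h gh]; first by rewrite /= divr_gt0.
apply: fP => w; rewrite (splitr e).
by rewrite (le_lt_trans (ler_distD (sup_fun g w) _ _))// ltrD.
Qed.

HB.instance Definition _ := Nbhs_isNbhsTopological.Build CW
  sup_nbhs_filter sup_nbhs_singleton sup_nbhs_nbhs.

Lemma sup_eval_continuous : continuous (fun p : CW * W => sup_fun p.1 p.2).
Proof.
move=> [f w]; apply/cvgrPdist_lt => e e0.
have e2 : 0 < e / 2 by rewrite divr_gt0.
have /cvgrPdist_lt /(_ _ e2) fw := @sup_fun_continuous f w.
exists (sup_ball f (e / 2), [set v | `|sup_fun f w - sup_fun f v| < e / 2]).
  by split => //; exists (e / 2).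
move=> [g v] [/= fg fv]; rewrite (splitr e).
by rewrite (le_lt_trans (ler_distD (sup_fun f v) _ _))// ltrD.
Qed.

Lemma sup_sub_continuous (f g : CW) :
  continuous (fun w => sup_fun f w - sup_fun g w).
Proof. by move=> w; apply: cvgB; exact: sup_fun_continuous. Qed.

Hypothesis cW : compact [set: W].

(** The exponential law for compact [W]. All maps into function spaces below get their continuity
    from it. *)
Lemma sup_curry_continuous (T : topologicalType) (F : T * W -> R)
    (G : T -> CW) : continuous F ->
  (forall t w, sup_fun (G t) w = F (t, w)) -> continuous G.
Proof.
move=> cF GE t P [e /= e0 GP].
(* [near_sup_norm] gives a weak inequality; halving [e] makes it strict. *)
have e2 : 0 < e / 2 by rewrite divr_gt0.
apply: filterS (near_sup_norm cW cF t e2) => t' le.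
apply: GP => w; rewrite !GE.
have cs : continuous (fun w => F (t, w) - F (t', w)).
  by move=> v; apply: cvgB; exact: continuous_slice.
have /= := le_sup_norm cW cs (w := w) I; lra.
Qed.

Lemma sup_space_metrizable : metrizable R CW.
Proof.
exists (fun f g => sup_norm setT (fun w => sup_fun f w - sup_fun g w)).
have le f g w := le_sup_norm cW (@sup_sub_continuous f g) (w := w) I.
split.
- move=> f g; split=> [fg|->].
  + apply: sup_fun_inj; apply/funext => w; apply/eqP.
    rewrite -subr_eq0 -normr_le0; apply: le_trans (le f g w) _.
    by rewrite fg.
  + apply/eqP; rewrite eq_le sup_norm_ge0 andbT.
    by apply: sup_norm_le => // w _; rewrite subrr normr0.
- by move=> f g; rewrite sup_norm_subC.
- move=> f g h; apply: sup_norm_le => [|w _].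
    by rewrite addr_ge0// sup_norm_ge0.
  by rewrite (le_trans (ler_distD (sup_fun g w) _ _))// lerD// le.
- move=> f; apply/seteqP; split=> P [e /= e0 fP].
  + exists e => //= g fg; apply: fP => w; exact: le_lt_trans fg.
  + exists (e / 2) => [|g fg]; first by rewrite /= divr_gt0.
    apply: fP => /=; apply: (@le_lt_trans _ _ (e / 2)); last by lra.
    by apply: sup_norm_le => [|w _]; [lra|exact: ltW].
Qed.

End sup_space.

(** * Metrizable spaces: continuity of the distance, Hausdorffness, products *)

Section metrizable.
Context {R : realType} {T : topologicalType}.
Variable d : T -> T -> R.
Hypotheses (d0 : forall x y, d x y = 0 <-> x = y)
  (dC : forall x y, d x y = d y x)
  (dD : forall x y z, d x z <= d x y + d y z)
  (dE : forall x, nbhs x = nbhs_ball_ (fun x e => [set y | d x y < e]) x).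

Lemma dist_ge0 x y : 0 <= d x y.
Proof. by have := dD x y x; rewrite (dC y x) (d0 x x).2//; lra. Qed.

Lemma near_dist x e : 0 < e -> \forall y \near x, d x y < e.
Proof. by move=> e0; change (nbhs x [set y | d x y < e]); rewrite dE; exists e. Qed.

Lemma dist_continuous : continuous (fun p : T * T => d p.1 p.2).
Proof.
move=> [x y]; apply/cvgrPdist_lt => e e0 /=.
have e2 : 0 < e / 2 by rewrite divr_gt0.
exists ([set z | d x z < e / 2], [set z | d y z < e / 2]).
  by split; exact: near_dist.
move=> [x' y'] [/= xx yy].
have h1 := dD x x' y; have h2 := dD x' y' y; rewrite (dC y' y) in h2.
have h3 := dD x' x y'; have h4 := dD x y y'; rewrite (dC x' x) in h3.
by rewrite ltr_norml; apply/andP; split; lra.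
Qed.

Lemma dist_hausdorff : hausdorff_space T.
Proof.
move=> x y xy; apply/d0/eqP; rewrite eq_le dist_ge0 andbT.
rewrite leNgt; apply/negP => p0; have e2 : 0 < d x y / 2 by rewrite divr_gt0.
have [z [/= xz yz]] := xy _ _ (near_dist x e2) (near_dist y e2).
by have := dD x z y; rewrite (dC z y); lra.
Qed.

End metrizable.

Lemma metrizable_hausdorff (R : realType) (T : topologicalType) :
  metrizable R T -> hausdorff_space T.
Proof. by move=> [d [d0 dC dD dE]]; exact: (dist_hausdorff d0 dC dD dE). Qed.

Lemma metrizable_prod (R : realType) (S T : topologicalType) :
  metrizable R S -> metrizable R T -> metrizable R (S * T)%type.
Proof.
move=> [d [d0 dC dD dE]] [d' [d'0 d'C d'D d'E]].
have p := dist_ge0 d0 dC dD; have p' := dist_ge0 d'0 d'C d'D.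
exists (fun x y => d x.1 y.1 + d' x.2 y.2); split.
- move=> [x x'] [y y'] /=; split=> [e|[-> ->]]; last first.
    by rewrite (d0 y y).2// (d'0 y' y').2// addr0.
  have px := p x y; have px' := p' x' y'.
  by congr pair; [apply/d0|apply/d'0]; lra.
- by move=> x y; rewrite dC d'C.
- move=> x y z; have := dD x.1 y.1 z.1; have := d'D x.2 y.2 z.2; lra.
move=> [x x']; apply/seteqP; split=> P.
- move=> [[A B] /= []]; rewrite !dE d'E => -[e /= e0 eA] [e' /= e0' eB] AB.
  exists (Num.min e e') => [|[y y'] /=]; first by rewrite /= lt_min e0 e0'.
  rewrite lt_min => /andP[h h']; have px := p x y; have px' := p' x' y'.
  by apply: AB; split; [apply: eA|apply: eB] => /=; lra.
- move=> [e /= e0 eP].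
  have e2 : 0 < e / 2 by rewrite divr_gt0.
  exists ([set z | d x z < e / 2], [set z | d' x' z < e / 2]).
    by split; [exact: (near_dist dE)|exact: (near_dist d'E)].
  by move=> [y y'] [/= h h']; apply: eP => /=; lra.
Qed.

(** * Invariant cut-off functions *)

Section separation.
Context {R : realType} {K : compactGroupType} {Z : gspace K}.
Hypotheses (cZ : compact [set: Z]) (mZ : metrizable R Z).

(** The function is the distance from the orbit of [z] to the complement of [U], truncated at 1. It
    is written as 1 minus the sup over [g] and over [w] outside [U] of [max 0 (1 - d (g z) w)], so
    that [sup_norm_continuous] applies. For [z] outside [U] the pair [(1, z)] already gives the
    value 1; for [z] in [U] all values are below 1, hence so is their sup by compactness. *)
Lemma invariant_support (U : set Z) : open U -> ginvariant U ->
  exists f : Z -> R, [/\ continuous f, forall g z, f (gact g z) = f z,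
    forall z, U z -> 0 < f z & forall z, ~ U z -> f z <= 0].
Proof.
move=> oU hU; have [d [d0 dC dD dE]] := mZ.
pose C : set (K * Z) := setT `*` ~` U.
have cC : compact C.
  apply: compact_setX; first exact: compactT.
  by apply: (subclosed_compact _ cZ) => //; exact: open_closedC.
pose F (p : Z * (K * Z)) : R := Num.max 0 (1 - d (gact p.2.1 p.1) p.2.2).
have cF : continuous F.
  have cd := dist_continuous dC dD dE.
  move=> p; apply: (@continuous_max _ _ (cst 0)
    (fun p => 1 - d (gact p.2.1 p.1) p.2.2)); first exact: cvg_cst.
  apply: cvgB; first exact: cvg_cst.
  apply: (@continuous_compose _ _ _
    (fun p : Z * (K * Z) => (gact p.2.1 p.1, p.2.2)) (fun q => d q.1 q.2)) => //.
  apply: continuous_pair; last first.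
    by apply: (@continuous_compose _ _ _ snd snd); cts.
  apply: (@continuous_compose _ _ _
    (fun p : Z * (K * Z) => (p.2.1, p.1)) (fun q => gact q.1 q.2));
    last exact: gact_continuous.
  by apply: continuous_pair; cts; apply: (@continuous_compose _ _ _ snd fst); cts.
have F0 p : 0 <= F p by rewrite le_max lexx.
have dp := dist_ge0 d0 dC dD.
have F1 p : F p <= 1 by rewrite ge_max ler01 /= lerBlDr lerDl.
exists (fun z => 1 - sup_norm C (fun w => F (z, w))); split.
- move=> z; apply: cvgB; first exact: cvg_cst.
  exact: sup_norm_continuous.
(* Right translation by [g] in the group coordinate permutes [C]. *)
- move=> g z; congr (1 - inf _); apply/seteqP; split=> e [e0 le]; split=> //.
  + move=> [h w] [_ Uw]; have := le ((h * g^-1)%g, w) (conj I Uw).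
    by rewrite /F /= -gactM mulgVK.
  + move=> [h w] [_ Uw]; have := le ((h * g)%g, w) (conj I Uw).
    by rewrite /F /= -gactM.
- move=> z Uz; rewrite subr_gt0; apply: sup_norm_lt => //.
    exact: continuous_slice.
  move=> [g w] [_ /= Uw]; rewrite ger0_norm// /F gt_max ltr01 /=.
  suff : d (gact g z) w != 0.
    by rewrite ltrBlDr ltrDl lt_neqAle eq_sym => ->; rewrite dp.
  apply/eqP => /d0 gz; apply: Uw; rewrite -gz; exact: hU.
- move=> z Uz; rewrite subr_le0.
  have := le_sup_norm cC (@continuous_slice _ _ _ _ cF z) (w := (1%g, z)) (conj I Uz).
  rewrite ger0_norm// /F /= gact1 (d0 z z).2// subr0; apply: le_trans.
  by rewrite le_max lexx orbT.
Qed.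

End separation.

(** * Subspaces, gluing of continuous maps, and the unit interval *)

Lemma continuous_subval (T : topologicalType) (A : set T) :
  continuous (val : set_type A -> T).
Proof. exact: (@initial_continuous (set_type A) T val). Qed.

Lemma continuous_into_sub (S T : topologicalType) (A : set T)
    (f : S -> set_type A) : continuous (fun s => val (f s)) -> continuous f.
Proof.
move=> cf; apply/continuousP => _ [B oB <-].
by move/continuousP: cf => /(_ _ oB).
Qed.

Lemma continuous_sub_local (S T : topologicalType) (U : set S) (f : S -> T) :
  open U -> continuous (fun u : set_type U => f (val u)) ->
  forall x, U x -> {for x, continuous f}.
Proof.
move=> oU cf x Ux; have /subspace_sigL_continuousP := cf.
by rewrite continuous_open_subspace// => /(_ x); apply; exact/mem_set.
Qed.

Lemma continuous_near_eq (S T : topologicalType) (f g : S -> T) x :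
  continuous g -> (\forall y \near x, f y = g y) -> {for x, continuous f}.
Proof.
move=> cg fg P; rewrite (nbhs_singleton fg) => /cg; apply: filterS2 fg => y.
by rewrite /= => ->.
Qed.

(** Off the level [phi x = c] only one branch is seen nearby. On it both branches have the same
    value, and a neighbourhood of that value pulls back under both. *)
Lemma continuous_if_le (R : realType) (S T : topologicalType) (f g : S -> T)
    (phi : S -> R) (c : R) : continuous f -> continuous g -> continuous phi ->
  (forall x, phi x = c -> f x = g x) ->
  continuous (fun x => if phi x <= c then f x else g x).
Proof.
move=> cf cg cphi fg x; have [xc|xc|xc] := ltgtP (phi x) c.
- apply: (continuous_near_eq cf); have /cvgr_lt /(_ _ xc) := cphi x.
  by apply: filterS => y /ltW ->.
- apply: (continuous_near_eq cg); have /cvgr_gt /(_ _ xc) := cphi x.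
  by apply: filterS => y; rewrite ltNge => /negbTE ->.
- move=> P; rewrite xc lexx => fP; have gP := fP; rewrite (fg _ xc) in gP.
  change (nbhs x [set y | P (if phi y <= c then f y else g y)]).
  have cfP : nbhs x (f @^-1` P) := cf _ _ fP.
  have cgP : nbhs x (g @^-1` P) := cg _ _ gP.
  by apply: filterS2 cfP cgP => y /=; case: ifP.
Qed.

Section unit_interval.
Context {R : realType}.
Local Notation I := (unit_interval R).

Definition ival (t : I) : R := val t.

Lemma ival_continuous : continuous ival.
Proof. exact: continuous_subval. Qed.

Lemma ival_ge0 t : 0 <= ival t.
Proof. by have /set_mem := valP t; rewrite /= in_itv => /andP[]. Qed.

Fact clamp_subproof (x : R) : Num.min 1 (Num.max 0 x) \in (`[0, 1]%classic : set R).
Proof.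
apply/mem_set; rewrite /= in_itv /= ge_min lexx andbT le_min ler01 /=.
by rewrite le_max lexx.
Qed.

(** The retraction of the line onto the interval. It allows homotopies to be reparametrized by any
    continuous real function, with no condition on its range. *)
Definition clamp (x : R) : I :=
  exist _ (Num.min 1 (Num.max 0 x)) (clamp_subproof x).

Lemma clamp_continuous : continuous clamp.
Proof.
have c0 : continuous (fun x : R => Num.max 0 x).
  by move=> x; apply: (@continuous_max _ _ (cst 0) id); first exact: cvg_cst.
have c1 : continuous (fun x : R => Num.min 1 (Num.max 0 x)).
  move=> x; apply: (@continuous_min R R (cst 1) (fun y => Num.max 0 y)); last exact: c0.
  exact: cvg_cst.
exact: (@continuous_into_sub _ _ _ clamp c1).
Qed.

Lemma clamp_le0 x : x <= 0 -> clamp x = I0.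
Proof. by move=> x0; apply: val_inj => /=; rewrite max_l// min_r. Qed.

Lemma clamp_ge1 x : 1 <= x -> clamp x = I1.
Proof.
move=> x1; have x0 : 0 <= x by rewrite (le_trans _ x1).
by apply: val_inj => /=; rewrite max_r// min_l.
Qed.

End unit_interval.

(** * Equivariant maps and the calculus of equivariant homotopies *)

Section gmaps.
Context {K : topGroupType}.
Implicit Types X Y Z : gspace K.

Definition gmap_fst X Y : gmap (gprod X Y) X :=
  @GMap K (gprod X Y) X fst (@continuous_fst X Y) (fun _ _ => erefl).

Definition gmap_snd X Y : gmap (gprod X Y) Y :=
  @GMap K (gprod X Y) Y snd (@continuous_snd X Y) (fun _ _ => erefl).

Program Definition gmap_into Y Z (A : set Z) (hA : ginvariant A) (f : gmap Y Z)
    (fA : forall y, A (f y)) : gmap Y (gsub hA) :=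
  @GMap K Y (gsub hA) (fun y => exist _ (f y) (mem_set (fA y))) _ _.
Next Obligation.
by move=> *; apply: continuous_into_sub; exact: gfun_continuous.
Qed.
Next Obligation. by move=> *; apply: val_inj; rewrite /= gfun_equivariant. Qed.

Program Definition cylinder_at (R : realType) Z (t : unit_interval R) :
    gmap Z (cylinder R Z) :=
  @GMap K Z (cylinder R Z) (fun z => (z, t)) _ _.
Next Obligation.
by move=> *; apply: continuous_pair; [exact: continuous_id|exact: continuous_const].
Qed.
Next Obligation. by []. Qed.

End gmaps.
Arguments gmap_fst {K} X Y.
Arguments gmap_snd {K} X Y.
Arguments gmap_into {K Y Z A} hA f fA.
Arguments cylinder_at {K R} Z t.

Section homotopies.
Context {R : realType} {K : topGroupType}.
Implicit Types X Y Z : gspace K.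

Lemma ghomotopic_compl X Y Z (f h : gmap X Y) (k : gmap Y Z) :
  ghomotopic R f h -> ghomotopic R (gmap_comp k f) (gmap_comp k h).
Proof.
move=> [H HE]; exists (gmap_comp k H) => x /=.
by have [-> ->] := HE x.
Qed.

Lemma ghomotopic_compr X Y Z (f h : gmap Y Z) (k : gmap X Y) :
  ghomotopic R f h -> ghomotopic R (gmap_comp f k) (gmap_comp h k).
Proof.
move=> [H HE].
by exists (gmap_comp H (gmap_prod k (gmap_id _))) => x /=; exact: HE.
Qed.

Program Definition reparam Y Z (H : gmap (cylinder R Y) Z) (p : R -> R)
    (cp : continuous p) : gmap (cylinder R Y) Z :=
  @GMap K (cylinder R Y) Z (fun q => H (q.1, clamp (p (ival q.2)))) _ _.
Next Obligation.
move=> Y Z H p cp.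
apply: (@continuous_compose (cylinder R Y) (cylinder R Y) Z
  (fun q => (q.1, clamp (p (ival q.2)))) H); last exact: gfun_continuous.
apply: continuous_pair; first exact: continuous_fst.
apply: (@continuous_compose _ _ _ (fun q : cylinder R Y => p (ival q.2)) clamp);
  last exact: clamp_continuous.
apply: (@continuous_compose _ _ _ (fun q : cylinder R Y => ival q.2) p) => //.
apply: (@continuous_compose _ _ _ snd ival); first exact: continuous_snd.
exact: ival_continuous.
Qed.
Next Obligation. by move=> Y Z H p cp g [y t]; rewrite /= -gfun_equivariant. Qed.

Lemma ghomotopic_sym Y Z (f h : gmap Y Z) :
  ghomotopic R f h -> ghomotopic R h f.
Proof.
move=> [H HE].
have cp : continuous (fun t : R => 1 - t).
  by move=> t; apply: cvgB; [exact: cvg_cst|exact: cvg_id].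
exists (reparam H cp) => y /=.
by rewrite (@clamp_ge1 _ (1 - 0)) ?subr0// clamp_le0 ?subrr//; case: (HE y).
Qed.

Lemma ghomotopic_trans Y Z (f h k : gmap Y Z) :
  ghomotopic R f h -> ghomotopic R h k -> ghomotopic R f k.
Proof.
move=> [H HE] [L LE].
have cp : continuous (fun t : R => 2 * t).
  by move=> t; apply: cvgM; [exact: cvg_cst|exact: cvg_id].
have cq : continuous (fun t : R => 2 * t - 1).
  by move=> t; apply: cvgB; [exact: cp|exact: cvg_cst].
pose E (q : cylinder R Y) :=
  if ival q.2 <= 2^-1 then reparam H cp q else reparam L cq q.
have cE : continuous E.
  apply: (@continuous_if_le R (cylinder R Y) Z _ _ (fun q => ival q.2)).
  - exact: gfun_continuous.
  - exact: gfun_continuous.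
  - apply: (@continuous_compose _ _ _ snd ival); first exact: continuous_snd.
    exact: ival_continuous.
  - move=> [y t] /= ->.
    rewrite clamp_ge1 ?mulfV// clamp_le0 ?subrr//.
    by rewrite (HE y).2 (LE y).1.
have eE g q : E (gact g q) = gact g (E q).
  by case: q => y t; rewrite /E /=; case: ifP => _; rewrite -gfun_equivariant.
exists (GMap cE eE) => y; rewrite /= /E /=; split.
- by rewrite invr_ge0 ler0n clamp_le0 ?mulr0//; case: (HE y).
- rewrite lt_geF ?invf_lt1 ?ltr1n// clamp_ge1; last by rewrite mulr1; lra.
  by case: (LE y).
Qed.

End homotopies.

(** * Powers of [Z] and the fat sum as a subspace of a power *)

Lemma prod_hausdorff (S T : topologicalType) :
  hausdorff_space S -> hausdorff_space T -> hausdorff_space (S * T)%type.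
Proof.
move=> hS hT [x y] [x' y'] c; congr pair; [apply: hS|apply: hT] => A B nA nB.
- have [||[u v] /= [Au Bu]] := c (A `*` setT) (B `*` setT).
  + by exists (A, setT) => //; split => //; exact: filterT.
  + by exists (B, setT) => //; split => //; exact: filterT.
  + by exists u; split; [case: Au|case: Bu].
- have [||[u v] /= [Au Bu]] := c (setT `*` A) (setT `*` B).
  + by exists (setT, A) => //; split => //; exact: filterT.
  + by exists (setT, B) => //; split => //; exact: filterT.
  + by exists v; split; [case: Au|case: Bu].
Qed.

Lemma set_type_compact (T : topologicalType) (A : set T) :
  compact A -> compact [set: set_type A].
Proof.
move=> cA; apply/compact_near_coveringP => I F P FF FP.
(* [P] concerns points of the subtype; quantifying over those lying above [x] turns it into a
   property of points of [T]. *)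
have : \forall i \near F, A `<=` (fun x => forall a : set_type A, val a = x -> P i a).
  move/compact_near_coveringP/near_covering_withinP : cA; apply => x Ax.
  have [[V W] [/= [_ [[B oB <-] /= Bx BV]] FW] VW] :=
    FP (exist _ x (mem_set Ax)) Logic.I.
  exists (B, W) => /=; first by split=> //; exact: open_nbhs_nbhs.
  move=> [y i] [/= By Wi] _ a ay.
  by apply: (VW (a, i)); split=> //; apply: BV; subst y.
by apply: filterS => i AP a _; apply: AP (erefl _); exact: set_mem (valP a).
Qed.

Section powers.
Context {K : compactGroupType} (Z : gspace K).

Lemma gpowS_hausdorff m : hausdorff_space Z -> hausdorff_space (gpowS Z m).
Proof. by move=> hZ; elim: m => //= m IH; exact: prod_hausdorff. Qed.

(** Indices are natural numbers, which keeps the recursion free of ordinals. An index beyond [m]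
    gives the last coordinate. *)
Fixpoint gproj (m i : nat) : gmap (gpowS Z m) Z :=
  match m with
  | 0 => gmap_id Z
  | m'.+1 =>
    if i is i'.+1 then
      gmap_comp (gproj m' i') (gmap_snd Z (gpowS Z m'))
    else gmap_fst Z (gpowS Z m')
  end.

Lemma gproj_diag m i z : gproj m i (gdiagS Z m z) = z.
Proof. by elim: m i => [//|m IH] [|i] //=. Qed.

Fixpoint gtuple (Y : gspace K) (m : nat) (q : nat -> gmap Y Z) :
    gmap Y (gpowS Z m) :=
  if m is m'.+1 then gmap_pair (q 0%N) (gtuple m' (fun i => q i.+1)) else q 0%N.

Lemma gproj_tuple (Y : gspace K) m (q : nat -> gmap Y Z) i y :
  (i <= m)%N -> gproj m i (gtuple m q y) = q i y.
Proof.
elim: m i q => [|m IH] [|i] q //= im.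
exact: (IH i (fun i => q i.+1) im).
Qed.

Lemma gtuple_diag (Y : gspace K) m (q : nat -> gmap Y Z) y z :
  (forall i, q i y = z) -> gtuple m q y = gdiagS Z m z.
Proof.
move=> qz; elim: m q qz => [|m IH] q qz /=; first exact: qz.
by rewrite qz; congr pair; exact: IH.
Qed.

Lemma gtuple_eq (Y Y' : gspace K) m (q : nat -> gmap Y Z)
    (q' : nat -> gmap Y' Z) y y' :
  (forall i, q i y = q' i y') -> gtuple m q y = gtuple m q' y'.
Proof.
move=> qq; elim: m q q' qq => [|m IH] q q' qq /=; first exact: qq.
by rewrite qq; congr pair; apply: IH => i.
Qed.

Lemma ghomotopic_tuple (R : realType) (Y : gspace K) m (q q' : nat -> gmap Y Z) :
  (forall i, ghomotopic R (q i) (q' i)) ->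
  ghomotopic R (gtuple m q) (gtuple m q').
Proof.
move=> /choice [H HE]; exists (gtuple m H) => y.
by split; apply: gtuple_eq => i; case: (HE i y).
Qed.

End powers.

Lemma pushout_compact (K : compactGroupType) (C X Y : gspace K)
    (f : gmap C X) (h : gmap C Y) :
  compact [set: X] -> compact [set: Y] -> compact [set: pushout f h].
Proof.
move=> cX cY.
have -> : [set: pushout f h] = range (po_inl f h) `|` range (po_inr f h).
  apply/seteqP; split=> // q _.
  by elim/(@po_ind _ _ _ _ f h): q => z; [left|right]; exists z.
by apply: compactU; apply: continuous_compact => //;
  apply: continuous_subspaceT; exact: gfun_continuous.
Qed.

Section fat_step.
Context {K : compactGroupType} {Z F P : gspace K} {A : set Z}.
Variables (hA : ginvariant A) (j : gmap F P).
Hypothesis jI : injective j.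

Let f := gmap_prod (gmap_id (gsub hA)) j.
Let h := gmap_prod (gincl hA) (gmap_id F).
(** The successor step of [fat_sumS], with an arbitrary [j] in place of the map of the previous fat
    sum. *)
Definition fat_step : gmap (pushout f h) (gprod Z P) :=
  @po_map _ _ _ _ f h (gprod Z P)
    (gmap_prod (gincl hA) (gmap_id P)) (gmap_prod (gmap_id Z) j)
    (fun _ => erefl).
Local Notation k := fat_step.

Let kl a w : k (po_inl_fun f h (a, w)) = (val a, w).
Proof. by rewrite /= po_desc_inl. Qed.

Let kr z q : k (po_inr_fun f h (z, q)) = (z, j q).
Proof. by rewrite /= po_desc_inr. Qed.

Let glue a q : po_inl_fun f h (a, j q) = po_inr_fun f h (val a, q).
Proof. exact: (po_glue f h (a, q)). Qed.

(** If points of different summands have the same image, its first coordinate is in [A] and its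
    second in the range of [j]; the two points are then glued along [A * F]. *)
Lemma fat_step_inj : injective k.
Proof.
move=> q q'; elim/(@po_ind _ _ _ _ f h): q => -[a w];
  elim/(@po_ind _ _ _ _ f h): q' => -[a' w'].
- by rewrite !kl => -[/val_inj -> ->].
- by rewrite kl kr => -[<- ->]; exact: glue.
- by rewrite kl kr => -[-> <-]; exact/esym/glue.
- by rewrite !kr => -[-> /jI ->].
Qed.

Lemma fat_step_range : range k = [set w | A w.1 \/ range j w.2].
Proof.
apply/seteqP; split=> [_ [q _ <-]|[z w] /= [Az|[q _ <-]]].
- elim/(@po_ind _ _ _ _ f h): q => -[a w].
    by rewrite kl; left; exact: set_mem (valP a).
  by rewrite kr; right; exists w.
- by exists (po_inl_fun f h (exist _ z (mem_set Az), w)); last exact: kl.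
- by exists (po_inr_fun f h (z, q)); last exact: kr.
Qed.

End fat_step.

Section fat_sum.
Context {K : compactGroupType} {Z : gspace K} {A : set Z} (hA : ginvariant A).

(** The fat wedge as a subset of the power, which [fat_sumS_embedding] shows to be the image of the
    fat sum. *)
Fixpoint fat (m : nat) : set (gpowS Z m) :=
  match m with
  | 0 => A
  | m'.+1 => [set w : Z * gpowS Z m' | A w.1 \/ fat w.2]
  end.

Lemma fatP m (w : gpowS Z m) :
  fat w <-> exists2 i, (i <= m)%N & A (gproj Z m i w).
Proof.
elim: m w => [|m IH] w /=.
  by split=> [Aw|[]//]; exists 0%N.
split=> [[Aw|/IH [i im Aw]]|[[|i] im Aw]].
- by exists 0%N.
- by exists i.+1.
- by left.
- by right; apply/IH; exists i.
Qed.

Let good m (s : {F : gspace K & gmap F (gpowS Z m)}) :=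
  [/\ compact [set: projT1 s], injective (projT2 s) &
      range (projT2 s) = @fat m].

Lemma fat_sumS_embedding m : closed A -> compact [set: Z] ->
  compact [set: projT1 (fat_sumS hA m)] /\
  injective (projT2 (fat_sumS hA m)) /\
  range (projT2 (fat_sumS hA m)) = @fat m.
Proof.
move=> clA cZ.
have cA : compact [set: gsub hA].
  by apply: set_type_compact; exact: subclosed_compact cZ _.
suff [] : good (fat_sumS hA m) by [].
elim: m => [|m IH].
  split=> //=; first by move=> a b; exact: val_inj.
  apply/seteqP; split=> [_ [a _ <-]|z Az]; first exact: set_mem (valP a).
  by exists (exist _ z (mem_set Az)).
(* The step is stated for an abstract [s], so that the dependent pair can be destructed. *)
have step s : good s -> good (let: existT F j := s in
    existT (fun F => gmap F (gpowS Z m.+1)) _ (fat_step hA j)); last exact: step IH.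
case: s => F j [/= cF jI jE].
have cpow : compact [set: gpowS Z m].
  elim: {F j cF jI jE IH} m => //= m IH.
  by rewrite -setXTT; exact: compact_setX.
split.
- apply: (@pushout_compact _ _ (gprod (gsub hA) (gpowS Z m)) (gprod Z F));
    by rewrite -setXTT; exact: compact_setX.
- exact: (@fat_step_inj _ _ _ _ _ hA j jI).
- by apply: etrans (@fat_step_range _ _ _ _ _ hA j) _; rewrite jE.
Qed.

(** The fat sum is compact and the power is Hausdorff, so the injection between them is a closed
    map. Hence the pointwise lift is continuous, and injectivity makes it equivariant. *)
Lemma fat_lift (Y : gspace K) m (g : gmap Y (gpowS Z m)) : closed A ->
  compact [set: Z] -> hausdorff_space Z -> (forall y, fat (g y)) ->
  exists xi : gmap Y (projT1 (fat_sumS hA m)),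
    forall y, projT2 (fat_sumS hA m) (xi y) = g y.
Proof.
move=> clA cZ hZ gfat.
have [] := fat_sumS_embedding m clA cZ.
move: (projT1 _) (projT2 _) => F j cF [jI jE].
have /choice [xi xiE] : forall y, exists q, j q = g y.
  by move=> y; have := gfat y; rewrite -jE => -[q _]; exists q.
have cxi : continuous xi.
  apply/continuous_closedP => C clC.
  have -> : xi @^-1` C = g @^-1` (j @` C).
    apply/seteqP; split=> y /=; first by exists (xi y).
    by move=> [q Cq]; rewrite -xiE => /jI <-.
  have /continuous_closedP := @gfun_continuous _ _ _ g; apply.
  apply: compact_closed; first exact: gpowS_hausdorff.
  apply: continuous_compact; last exact: subclosed_compact cF _.
  by apply: continuous_subspaceT; exact: gfun_continuous.
have exi a y : xi (gact a y) = gact a (xi y).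
  by apply: jI; rewrite gfun_equivariant !xiE gfun_equivariant.
by exists (GMap cxi exi).
Qed.

End fat_sum.

(** * Comparison of the covering category with the Whitehead category *)

Section extension.
Context {R : realType} {K : topGroupType} {Z : gspace K} {A : set Z}.

(* The homotopy is slowed down by a cut-off function of [f] which vanishes where
   [f <= e / 2], so that it extends by the identity outside [U]. *)
Lemma compressible_extend (U : set Z) (hU : ginvariant U) (f : Z -> R) (e : R) :
  open U -> compressible R A hU -> continuous f ->
  (forall g z, f (gact g z) = f z) -> (forall z, ~ U z -> f z <= 0) -> 0 < e ->
  exists2 q : gmap Z Z, ghomotopic R (gmap_id Z) q &
    forall z, e <= f z -> A (q z).
Proof.
move=> oU [c cA [H HE]] cf fi fU e0.
(* [mu] is affine in [f], with value 0 at [f = e / 2] and 1 at [f = e]. Time is multiplied by it and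
   then clamped. *)
pose mu z := 2 * f z / e - 1.
have cmu : continuous mu.
  move=> z; apply: cvgB; last exact: cvg_cst.
  by apply: cvgM; [apply: cvgM; [exact: cvg_cst|exact: cf]|exact: cvg_cst].
have mu0 z : f z < e / 2 -> mu z <= 0.
  by move=> fz; rewrite subr_le0 ler_pdivrMr// mul1r; lra.
have mu1 z : e <= f z -> 1 <= mu z.
  by move=> fz; rewrite lerBrDr ler_pdivlMr//; lra.
pose s (p : cylinder R Z) : unit_interval R := clamp (ival p.2 * mu p.1).
have cs : continuous s.
  apply: (@continuous_compose _ _ _ (fun p : cylinder R Z => ival p.2 * mu p.1)
    clamp); last exact: clamp_continuous.
  move=> p; apply: cvgM.
    have c2 : continuous (fun p : cylinder R Z => ival p.2).
      by apply: (@continuous_compose _ _ _ snd ival); cts; exact: ival_continuous.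
    exact: c2.
  have c1 : continuous (fun p : cylinder R Z => mu p.1).
    by apply: (@continuous_compose _ _ _ fst mu); cts.
  exact: c1.
have s0 p : f p.1 < e / 2 -> s p = I0.
  by move=> /mu0 mp; apply: clamp_le0; rewrite mulr_ge0_le0// ival_ge0.
pose E (p : cylinder R Z) : Z :=
  match pselect (U p.1) with
  | left u => H (exist _ p.1 (mem_set u), s p)
  | right _ => p.1
  end.
have EU (p : cylinder R Z) (u : p.1 \in U) : E p = H (exist _ p.1 u, s p).
  rewrite /E; case: pselect => [u'|nu]; last by case: nu; exact: set_mem.
  by congr (H (_, _)); exact: val_inj.
have EnU (p : cylinder R Z) : ~ U p.1 -> E p = p.1.
  by rewrite /E; case: pselect.
have cE : continuous E.
  move=> p; have [Up|nUp] := pselect (U p.1); last first.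
    (* Outside [U] one has [f <= 0], so [f < e / 2] persists nearby; there [s] is [I0] and [E] is
       the first projection. *)
    apply: (@continuous_near_eq (cylinder R Z) Z E fst); first exact: continuous_fst.
    have fp : f p.1 < e / 2 by apply: le_lt_trans (fU _ nUp) _; lra.
    have cf1 : continuous (fun q : cylinder R Z => f q.1).
      by apply: (@continuous_compose _ _ _ fst f); cts.
    have /cvgr_lt /(_ _ fp) := cf1 p.
    apply: filterS => q /= fq; have [Uq|nUq] := pselect (U q.1); last exact: EnU.
    by rewrite (EU _ (mem_set Uq)) s0//; have [->] := HE (exist _ q.1 (mem_set Uq)).
  apply: (@continuous_sub_local (cylinder R Z) Z [set q | U q.1]) => //.
    by have /continuousP := @continuous_fst Z (unit_interval R); exact.
  pose w (q : set_type [set q : cylinder R Z | U q.1]) : gsub hU :=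
    exist _ (val q).1 (mem_set (set_mem (valP q))).
  have Ew : (fun q : set_type [set q : cylinder R Z | U q.1] => E (val q)) =
      (fun q => H (w q, s (val q))).
    apply/funext => q; rewrite (EU _ (mem_set (set_mem (valP q)))).
    by congr (H (_, _)); exact: val_inj.
  rewrite Ew; apply: (@continuous_compose _ (cylinder R (gsub hU)) Z
    (fun q => (w q, s (val q))) H); last exact: gfun_continuous.
  have cval := @continuous_subval (cylinder R Z) [set q | U q.1].
  apply: continuous_pair; last exact: continuous_compose cval cs.
  by apply: continuous_into_sub; exact: continuous_compose cval (@continuous_fst _ _).
have eE g p : E (gact g p) = gact g (E p).
  have sg : s (gact g p) = s p by rewrite /s /mu /= fi.
  have [Up|nUp] := pselect (U p.1).
    have Ug : U (gact g p).1 by exact: (hU _ _ Up).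
    rewrite (EU _ (mem_set Up)) (EU _ (mem_set Ug)) sg -gfun_equivariant.
    by congr (H (_, _)); exact: val_inj.
  rewrite !EnU// => Ug; apply: nUp.
  by rewrite -[p.1]gact1 -(mulVg g) gactM; exact: (hU _ _ Ug).
pose EM : gmap (cylinder R Z) Z := GMap cE eE.
exists (gmap_comp EM (cylinder_at Z I1)).
  exists EM => z /=; split=> //.
  have [Uz|nUz] := pselect (U z); last exact: EnU.
  rewrite (EU (z, I0) (mem_set Uz)) /s clamp_le0 ?mul0r//.
  by have [->] := HE (exist _ z (mem_set Uz)).
move=> z fz /=.
have Uz : U z by apply: contrapT => /fU; lra.
rewrite (EU (z, I1) (mem_set Uz)) /s clamp_ge1 ?mul1r ?mu1//.
have [_ ->] := HE (exist _ z (mem_set Uz)); apply: cA.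
by exists (exist _ z (mem_set Uz)).
Qed.

(** Supplies one [e] for which [compressible_extend] can be applied to all members of a cover while
    the sets where [e <= f i] still cover [Z]. *)
Lemma positive_cover_bound (n : nat) (f : 'I_n -> Z -> R) :
  compact [set: Z] -> (forall i, continuous (f i)) ->
  (forall z, exists i, 0 < f i z) ->
  exists2 e, 0 < e & forall z, exists i, e <= f i z.
Proof.
move=> cZ cf f0.
have : \forall e \near 0^'+, [set: Z] `<=` (fun z => exists i, e <= f i z).
  move/compact_near_coveringP : cZ; apply => z _.
  have [i fi] := f0 z; have fi2 : 0 < f i z / 2 by rewrite divr_gt0.
  near=> y e; exists i.
  have h1 : e < f i z / 2 by near: e; exact: nbhs_right_lt.
  have h2 : f i z / 2 < f i y.
    by near: y; have /cvgr_gt := cf i z; apply; lra.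
  by apply: ltW; exact: lt_trans h2.
move=> H; have : \forall e \near 0^'+,
    0 < e /\ [set: Z] `<=` (fun z => exists i, e <= f i z).
  by near=> e; split; [near: e; exact: nbhs_right_gt|near: e].
by move=> /filter_ex [e [e0 eZ]]; exists e => // z; exact: eZ.
Unshelve. all: by end_near. Qed.

End extension.

Section Whitehead.
Context {R : realType} {K : compactGroupType} {Z : gspace K} {A : set Z}.
Variable hA : ginvariant A.
Hypotheses (clA : closed A) (cZ : compact [set: Z]) (mZ : metrizable R Z).

Lemma gcat_le_Wh n : gcat_le R A n -> gcatWh_le R hA n.
Proof.
case: n => [|m] [U [HU UT]] /=.
  (* A cover by no sets leaves [Z] empty, which is the bound 0 in [gcatWh_le]. *)
  by move=> [z _]; have : setT z by []; rewrite -UT => -[[]].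
have /choice [f Hf] : forall i, exists f : Z -> R,
    [/\ continuous f, forall g z, f (gact g z) = f z,
    forall z, U i z -> 0 < f z & forall z, ~ U i z -> f z <= 0].
  by move=> i; have [oU [hU _]] := HU i; exact: invariant_support.
have [||e e0 eZ] := @positive_cover_bound R K Z _ f cZ.
- by move=> i; case: (Hf i).
- move=> z; have : setT z by []; rewrite -UT => -[i _ Uz]; exists i.
  by have [_ _ + _] := Hf i; exact.
have /choice [q Hq] : forall i, exists q : gmap Z Z,
    ghomotopic R (gmap_id Z) q /\ forall z, e <= f i z -> A (q z).
  move=> i; have [oU [hU cU]] := HU i; have [cf fi _ fU] := Hf i.
  by have [q h1 h2] := compressible_extend oU cU cf fi fU e0; exists q.
(* [inord k] is [k] for [k <= m], and [gtuple m] reads only these indices. *)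
pose p (k : nat) := q (inord k).
have [|xi xiE] := @fat_lift _ _ _ hA Z m (gtuple m p) clA cZ (metrizable_hausdorff mZ).
  move=> z; have [i ei] := eZ z; have im : (i <= m)%N by rewrite -ltnS.
  by apply/fatP; exists i => //; rewrite gproj_tuple// /p inord_val; exact: (Hq i).2.
exists xi.
have [L LE] : ghomotopic R (gtuple m p) (gtuple m (fun=> gmap_id Z)).
  by apply: ghomotopic_tuple => i; apply: ghomotopic_sym; case: (Hq (inord i)).
exists L => z /=; have [-> ->] := LE z; rewrite xiE; split=> //.
exact: gtuple_diag.
Qed.

Lemma Wh_le_gcat n (N : set Z) (hN : ginvariant N) :
  open N -> A `<=` N -> compressible R A hN ->
  gcatWh_le R hA n -> gcat_le R A n.
Proof.
move=> oN AN [c cA ch]; case: n => [nz|m [xi Hxi]].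
  (* For [n = 0] the family is indexed by the empty type ['I_0], and it covers because [Z] is
     empty. *)
  exists (fun=> setT); split=> [[]//|].
  by apply/seteqP; split=> // z _; case: nz; exists z.
pose j := projT2 (fat_sumS hA m).
(* Each coordinate of the lift is homotopic to the identity, the corresponding coordinate of the
   diagonal. *)
pose u i := gmap_comp (gproj Z m i) (gmap_comp j xi).
have uid i : ghomotopic R (gmap_id Z) (u i).
  apply: ghomotopic_sym; have [L LE] := ghomotopic_compl (gproj Z m i) Hxi.
  by exists L => z; have [-> ->] := LE z; rewrite /= gproj_diag.
exists (fun i => u i @^-1` N); split; last first.
  apply/seteqP; split=> // z _.
  have [_ [_ jE]] := fat_sumS_embedding hA m clA cZ.
  have : range j (j (xi z)) by exists (xi z).
  rewrite jE => /fatP [i im Ai].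
  by exists (Ordinal (im : (i < m.+1)%N)) => //; exact: AN.
move=> i; split.
  by have /continuousP := @gfun_continuous _ _ _ (u i); exact.
have hU : ginvariant (u i @^-1` N).
  by move=> g z /= Nz; rewrite !gfun_equivariant; exact: (hN _ _ Nz).
exists hU.
pose V := gmap_into hN (gmap_comp (u i) (gincl hU)) (fun z => set_mem (valP z)).
exists (gmap_comp c V); first by move=> _ [z _ <-]; apply: cA; exists (V z).
(* The inclusion is deformed first to [u i], which maps this set into [N], and then by the
   compression of [N]. *)
apply: (@ghomotopic_trans _ _ _ _ _ (gmap_comp (u i) (gincl hU))).
  have [L LE] := ghomotopic_compr (gincl hU) (uid i).
  by exists L => z; have [-> ->] := LE z.
have [L LE] := ghomotopic_compr V ch.
by exists L => z; have [-> ->] := LE z.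
Qed.

Lemma gcat_eq_Wh (N : set Z) (hN : ginvariant N) :
  open N -> A `<=` N -> compressible R A hN -> gcat R A = gcatWh R hA.
Proof.
move=> oN AN cN; congr least; apply/funext => n; apply/propext; split.
  exact: gcat_le_Wh.
exact: Wh_le_gcat cN.
Qed.

End Whitehead.

(** * Compressible neighbourhoods from homotopy extension *)

Section compressible_neighbourhood.
Context {R : realType} {K : topGroupType} {Z : gspace K} {A : set Z}.
Variable hA : ginvariant A.

(* Apply homotopy extension with values in [Z * {0} U A * [0, 1]]; the points
   moved off the bottom end up in [A]. *)
Lemma cofibration_compressible : closed_cofibration R hA ->
  exists (N : set Z) (hN : ginvariant N),
    [/\ open N, A `<=` N & compressible R A hN].
Proof.
move=> [_ hep].
pose M : set (cylinder R Z) := [set p | ival p.2 = 0 \/ A p.1].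
have hM : ginvariant M.
  by move=> g p [p0|Ap]; [left|right; exact: (hA _ Ap)].
have Mbot z : M (cylinder_at Z I0 z) by left.
have Mside q : M (gmap_prod (gincl hA) (gmap_id (gtriv (unit_interval R))) q).
  by right; exact: set_mem (valP q.1).
(* Both data are inclusions into [M], so [E] is an equivariant retraction of the cylinder onto
   [M]. *)
have [|E [E0 EA]] := hep _ (gmap_into hM _ Mbot) (gmap_into hM _ Mside).
  by move=> a; exact: val_inj.
pose E' : gmap (cylinder R Z) (cylinder R Z) := gmap_comp (gincl hM) E.
(* These are the points whose top point [(z, I1)] is retracted off the bottom, hence to a point over
   [A]. *)
pose N := [set z | 0 < ival (E' (z, I1)).2].
have hN : ginvariant N.
  move=> g z; rewrite /N /=.
  have -> : (gact g z, I1) = gact g ((z, I1) : cylinder R Z) by [].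
  by rewrite gfun_equivariant.
exists N, hN; split.
- pose phi z := ival (E' (z, I1)).2.
  have cphi : continuous phi.
    pose e := gmap_comp (gmap_snd Z (gtriv (unit_interval R)))
      (gmap_comp E' (cylinder_at Z I1)).
    exact: (@continuous_compose Z (unit_interval R) R e ival
      (@gfun_continuous _ _ _ e) ival_continuous).
  have /continuousP := cphi => /(_ _ (@open_gt _ 0)) //.
- move=> a Aa; rewrite /N /=.
  by have /= -> := EA (exist _ a (mem_set Aa)) I1; exact: ltr01.
(* The [Z]-coordinate of the retraction is the deformation: it is the inclusion at time 0 and lies
   in [A] at time 1. *)
pose D := gmap_comp (gmap_fst Z (gtriv (unit_interval R)))
  (gmap_comp E' (gmap_prod (gincl hN) (gmap_id (gtriv (unit_interval R))))).
exists (gmap_comp D (cylinder_at (gsub hN) I1)).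
  move=> _ [z _ <-]; have /= := set_mem (valP z); rewrite /N /=.
  by have /= [->|] := set_mem (valP (E (val z, I1))); first by rewrite ltxx.
by exists D => z; split=> //=; rewrite E0.
Qed.

End compressible_neighbourhood.

(** * Compressions into the diagonal and sections of the path fibration *)

Section diagonal.
Context {R : realType} {K : topGroupType} {X : gspace K}.

(** A compression [c] has equal coordinates, which links the two projections through [c].
    Conversely, a homotopy between the projections is used to move the first coordinate while the
    second stays fixed. *)
Lemma compressible_diagonalP (U : set (gprod X X)) (hU : ginvariant U) :
  compressible R (diagonal : set (gprod X X)) hU <->
  ghomotopic R (gmap_comp (gmap_fst X X) (gincl hU))
    (gmap_comp (gmap_snd X X) (gincl hU)).
Proof.
split=> [[c cD ch]|[H HE]].
  have cE u : (c u).1 = (c u).2 by apply: cD; exists u.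
  apply: (@ghomotopic_trans _ _ _ _ _ (gmap_comp (gmap_fst X X) c)).
    exact: ghomotopic_compl ch.
  have [L LE] := ghomotopic_compl (gmap_snd X X) (ghomotopic_sym ch).
  by exists L => u; have [-> ->] := LE u; rewrite /= cE.
exists (gmap_pair (gmap_comp (gmap_snd X X) (gincl hU))
  (gmap_comp (gmap_snd X X) (gincl hU))); first by move=> _ [u _ <-].
exists (gmap_pair H (gmap_comp (gmap_snd X X)
  (gmap_comp (gincl hU) (gmap_fst (gsub hU) _)))) => u /=.
by have [-> ->] := HE u; split=> //=; case: (val u).
Qed.

(** The exponential law for the compact-open topology on paths; uncurrying is continuous because the
    interval is compact Hausdorff. *)
Lemma ghomotopic_pathP (Y : gspace K) (f h : gmap Y X) :
  ghomotopic R f h <->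
  exists s : Y -> path_space R X,
    [/\ continuous s, forall g y, s (gact g y) = path_act g (s y) &
        forall y, path_fun (s y) I0 = f y /\ path_fun (s y) I1 = h y].
Proof.
have hI : hausdorff_space (unit_interval R).
  move=> x y xy; apply: val_inj; apply: (@Rhausdorff R) => P Q nP nQ.
  have [z [Pz Qz]] := xy _ _ (ival_continuous nP) (ival_continuous nQ).
  by exists (val z).
have cI : compact [set: unit_interval R].
  by apply: set_type_compact; exact: segment_compact.
split=> [[H HE]|[s [cs es sE]]].
  have cH y : continuous (fun t => H (y, t)).
    apply: (@continuous_compose _ (cylinder R Y) X (fun t => (y, t)) H);
      last exact: gfun_continuous.
    by apply: continuous_pair; [exact: continuous_const|exact: continuous_id].
  exists (fun y => mkcts (cH y) : continuousType (unit_interval R) X); split.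
  - apply: continuous_comp_initial.
    exact: (@continuous_curry_fun Y (unit_interval R) X H (@gfun_continuous _ _ _ H)).
  - move=> g y; apply/continuousEP => t /=.
    exact: (gfun_equivariant H g (y, t)).
  - by move=> y; exact: HE.
pose H (p : cylinder R Y) : X := path_fun (s p.1) p.2.
have cH : continuous H.
  have -> : H = uncurry (fun y t => path_fun (s y) t) by apply/funext => -[].
  apply: continuous_uncurry => //.
  (* Local compactness: the whole interval is a compact closed neighbourhood of [t]. *)
  - move=> t _; exists setT; first exact: filterT.
    by split; [exact: cI|exact: closedT].
  - have ci : continuous (fun gamma : path_space R X =>
        ((gamma : continuousType (unit_interval R) X)
          : {compact-open, unit_interval R -> X})) by exact: initial_continuous.
    exact: (continuous_compose cs ci).
  - by move=> y; exact: (@cts_fun _ _ (path_fun (s y))).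
have eH g p : H (gact g p) = gact g (H p) by rewrite /H /= es.
by exists (GMap cH eH) => y; exact: sE.
Qed.

Lemma TC_sub_gcat n : TC_sub_le R X n <-> gcat_le R (diagonal : set (gprod X X)) n.
Proof.
have key (U : set (gprod X X)) (hU : ginvariant U) :
    compressible R (diagonal : set (gprod X X)) hU <->
    exists s : gsub hU -> path_space R X, [/\ continuous s,
      forall g u, s (gact g u) = path_act g (s u) &
      forall u, (path_fun (s u) I0, path_fun (s u) I1) = gincl hU u].
  rewrite compressible_diagonalP ghomotopic_pathP.
  split=> -[s [cs es sE]]; exists s; split=> // u.
  - by have [-> ->] := sE u; rewrite /=; case: (val u).
  - by have /= <- := sE u.
by split=> -[U [HU UT]]; exists U; split=> // i; have [oU [hU]] := HU i;
  move=> /key kU; split=> //; exists hU.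
Qed.

End diagonal.

(** * Equivariant embedding in a function space and the neighbourhood of the diagonal *)

Section sup_gspace.
Context {R : realType} {G : compactGroupType} {X : gspace G}.
Hypothesis cX : compact [set: X].
Local Notation W := (G * X)%type.

Let cW : compact [set: W].
Proof. by rewrite -setXTT; apply: compact_setX => //; exact: compactT. Qed.

(** Translating the argument on the right makes [sup_act] a left action. *)
Let translate (h : G) (w : W) : W := ((w.1 * h)%g, w.2).

Let translate_continuous : continuous (fun p : G * W => translate p.1 p.2).
Proof.
apply: continuous_pair; last by apply: (@continuous_compose _ _ _ snd snd); cts.
apply: (@continuous_compose _ _ _ (fun p : G * W => (p.2.1, p.1))
  (fun q => (q.1 * q.2)%g)); last exact: mulg_continuous.
by apply: continuous_pair; cts; apply: (@continuous_compose _ _ _ snd fst); cts.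
Qed.

Fact sup_act_subproof (h : G) (f : sup_space R W) :
  continuous (fun w => sup_fun f (translate h w)).
Proof.
apply: (@continuous_compose _ _ _ (translate h) (sup_fun f));
  last exact: sup_fun_continuous.
apply: (@continuous_compose _ _ _ (fun w => (h, w))
  (fun p : G * W => translate p.1 p.2)) => //.
by apply: continuous_pair; [exact: continuous_const|exact: continuous_id].
Qed.

Definition sup_act (h : G) (f : sup_space R W) : sup_space R W :=
  sup_mk (@sup_act_subproof h f).

Let sup_actE h f w : sup_fun (sup_act h f) w = sup_fun f (translate h w).
Proof. by []. Qed.

Fact sup_act1 f : sup_act 1%g f = f.
Proof.
apply: sup_fun_inj; apply/funext => -[g x].
by rewrite sup_actE /translate mulg1.
Qed.

Fact sup_actM g h f : sup_act (g * h)%g f = sup_act g (sup_act h f).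
Proof.
apply: sup_fun_inj; apply/funext => -[k x].
by rewrite !sup_actE /translate /= mulgA.
Qed.

Fact sup_act_continuous :
  continuous (fun p : G * sup_space R W => sup_act p.1 p.2).
Proof.
apply: (@sup_curry_continuous R W cW _
  (fun q : (G * sup_space R W) * W => sup_fun q.1.2 (translate q.1.1 q.2))) => //.
apply: (@continuous_compose _ _ _
  (fun q : (G * sup_space R W) * W => (q.1.2, translate q.1.1 q.2))
  (fun p => sup_fun p.1 p.2)); last exact: sup_eval_continuous.
apply: continuous_pair.
  by apply: (@continuous_compose _ _ _ fst snd); cts.
apply: (@continuous_compose _ _ _
  (fun q : (G * sup_space R W) * W => (q.1.1, q.2))
  (fun p : G * W => translate p.1 p.2)) => //.
by apply: continuous_pair; cts; apply: (@continuous_compose _ _ _ fst fst); cts.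
Qed.

Definition sup_gspace : gspace G :=
  GSpace sup_act1 sup_actM sup_act_continuous.

Variable d : X -> X -> R.
Hypotheses (d0 : forall x y, d x y = 0 <-> x = y)
  (dC : forall x y, d x y = d y x)
  (dD : forall x y z, d x z <= d x y + d y z)
  (dE : forall x, nbhs x = nbhs_ball_ (fun x e => [set y | d x y < e]) x).

Let orbit_dist (q : X * W) : R := d (gact q.2.1 q.1) q.2.2.

Let orbit_dist_continuous : continuous orbit_dist.
Proof.
apply: (@continuous_compose _ _ _ (fun q : X * W => (gact q.2.1 q.1, q.2.2))
  (fun p => d p.1 p.2)); last exact: (dist_continuous dC dD dE).
apply: continuous_pair; last by apply: (@continuous_compose _ _ _ snd snd); cts.
apply: (@continuous_compose _ _ _ (fun q : X * W => (q.2.1, q.1))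
  (fun p => gact p.1 p.2)); last exact: gact_continuous.
by apply: continuous_pair; cts; apply: (@continuous_compose _ _ _ snd fst); cts.
Qed.

(** The straight segment between the functions attached to two points of [X], in uncurried form as
    [sup_curry_continuous] requires. *)
Let seg (q : cylinder R (gprod X X) * W) : R :=
  (1 - ival q.1.2) * orbit_dist (q.1.1.1, q.2) +
  ival q.1.2 * orbit_dist (q.1.1.2, q.2).

Let seg_continuous : continuous seg.
Proof.
have ct : continuous (fun q : cylinder R (gprod X X) * W => ival q.1.2).
  apply: (@continuous_compose _ _ _ (fun q : cylinder R (gprod X X) * W => q.1.2)
    ival); last exact: ival_continuous.
  by apply: (@continuous_compose _ _ _ fst snd); cts.
have c1 : continuous (fun q : cylinder R (gprod X X) * W =>
    orbit_dist (q.1.1.1, q.2)).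
  apply: (@continuous_compose _ _ _ (fun q : cylinder R (gprod X X) * W =>
    (q.1.1.1, q.2)) orbit_dist) => //.
  apply: continuous_pair; cts.
  apply: (@continuous_compose _ _ _ fst (fun p : cylinder R (gprod X X) => p.1.1)).
    exact: continuous_fst.
  by apply: (@continuous_compose _ _ _ fst fst); cts.
have c2 : continuous (fun q : cylinder R (gprod X X) * W =>
    orbit_dist (q.1.1.2, q.2)).
  apply: (@continuous_compose _ _ _ (fun q : cylinder R (gprod X X) * W =>
    (q.1.1.2, q.2)) orbit_dist) => //.
  apply: continuous_pair; cts.
  apply: (@continuous_compose _ _ _ fst (fun p : cylinder R (gprod X X) => p.1.2)).
    exact: continuous_fst.
  by apply: (@continuous_compose _ _ _ fst snd); cts.
move=> q; apply: cvgD; apply: cvgM.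
- by apply: cvgB; [exact: cvg_cst|exact: ct].
- exact: c1.
- exact: ct.
- exact: c2.
Qed.

Let segment_fun (p : cylinder R (gprod X X)) : sup_gspace :=
  sup_mk (@continuous_slice _ _ _ seg seg_continuous p).

Let segment_funE p w : sup_fun (segment_fun p) w = seg (p, w).
Proof. by []. Qed.

Fact segment_continuous : continuous segment_fun.
Proof. exact: (@sup_curry_continuous R W cW _ seg). Qed.

Fact segment_equivariant g p :
  segment_fun (gact g p) = gact g (segment_fun p).
Proof.
apply: sup_fun_inj; apply/funext => -[h z].
change (seg (gact g p, (h, z)) = seg (p, translate g (h, z))).
by rewrite /seg /orbit_dist /= !gactM.
Qed.

(* Identifying [x] with [(g, z) |-> d (g x) z], rather than with [d x], makes the
   embedding equivariant without an invariant metric. *)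
Definition segment : gmap (cylinder R (gprod X X)) sup_gspace :=
  GMap segment_continuous segment_equivariant.

(** Taken as the start of the segment from [x] to [x], it inherits continuity and equivariance from
    [segment]. *)
Definition orbit_embedding : gmap X sup_gspace :=
  gmap_comp segment
    (gmap_comp (cylinder_at _ I0) (gmap_pair (gmap_id X) (gmap_id X))).

Let orbit_embeddingE x w : sup_fun (orbit_embedding x) w = orbit_dist (x, w).
Proof.
change (seg ((x, x, I0), w) = orbit_dist (x, w)).
by rewrite /seg /= subr0 mul1r mul0r addr0.
Qed.

Lemma segment0 p : segment (p, I0) = orbit_embedding p.1.
Proof.
apply: sup_fun_inj; apply/funext => w; rewrite orbit_embeddingE.
by rewrite segment_funE /seg /= subr0 mul1r mul0r addr0.
Qed.

Lemma segment1 p : segment (p, I1) = orbit_embedding p.2.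
Proof.
apply: sup_fun_inj; apply/funext => w; rewrite orbit_embeddingE.
by rewrite segment_funE /seg /= subrr mul1r mul0r add0r.
Qed.

Lemma segment_diagonal x t : segment ((x, x), t) = orbit_embedding x.
Proof.
apply: sup_fun_inj; apply/funext => w; rewrite orbit_embeddingE.
by rewrite segment_funE /seg /=; ring.
Qed.

Lemma sup_gspace_metrizable : metrizable R sup_gspace.
Proof. exact: sup_space_metrizable. Qed.

Lemma orbit_embedding_closed : closed_embedding orbit_embedding.
Proof.
have ci := @gfun_continuous _ _ _ orbit_embedding.
have inj : injective orbit_embedding.
  move=> x y xy; apply/d0.
  (* At [(1, y)] the two functions take the values [d x y] and [d y y = 0]. *)
  have := congr1 (fun f => sup_fun f (1%g, y)) xy.
  by rewrite !orbit_embeddingE /orbit_dist /= !gact1 => ->; exact/d0.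
have cl (C : set X) : closed C -> closed (orbit_embedding @` C).
  move=> clC; apply: compact_closed.
    exact: metrizable_hausdorff sup_gspace_metrizable.
  apply: continuous_compact; first exact: continuous_subspaceT.
  exact: subclosed_compact cX _.
split=> // [|V]; first by apply: cl; exact: closedT.
split=> [oV|[B oB ->]]; last by move/continuousP : ci; exact.
exists (~` (orbit_embedding @` ~` V)).
  by apply: closed_openC; apply: cl; exact: open_closedC.
apply/seteqP; split=> x /=; first by move=> Vx [y nVy /inj yx]; apply: nVy; rewrite yx.
by move=> H; apply: contrapT => nVx; apply: H; exists x.
Qed.

End sup_gspace.

Lemma ganr_diagonal (R : realType) (G : compactGroupType) (X : gspace G) :
  compact [set: X] -> ganr R X ->
  exists (N : set (gprod X X)) (hN : ginvariant N),
    [/\ open N, diagonal `<=` N &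
        compressible R (diagonal : set (gprod X X)) hN].
Proof.
move=> cX [[d [d0 dC dD dE]] anr].
pose sg := segment cX dC dD dE; pose i := orbit_embedding cX dC dD dE.
have [U [hU [oU iU [r rE]]]] := anr _ i (sup_gspace_metrizable cX)
  (orbit_embedding_closed cX d0 dC dD dE).
pose N : set (gprod X X) := [set p | forall t, U (sg (p, t))].
have hN : ginvariant N.
  move=> g p Np t.
  have -> : (gact g p, t) = gact g ((p, t) : cylinder R (gprod X X)) by [].
  by rewrite gfun_equivariant; exact: (hU _ _ (Np t)).
exists N, hN; split.
- rewrite openE => p Np.
  have cI : compact [set: unit_interval R].
    by apply: set_type_compact; exact: segment_compact.
  (* A tube argument along the compact interval: a whole segment in the open set [U] keeps nearby
     segments in [U]. *)
  have H : \forall q \near p, [set: unit_interval R] `<=` (fun t => U (sg (q, t))).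
    move/compact_near_coveringP : cI.
    move/(_ _ (nbhs p) (fun q t => U (sg (q, t))) _); apply => t _.
    have nU : nbhs (sg (p, t)) U by apply: open_nbhs_nbhs; split=> //; exact: Np.
    have [[P Q] [/= nP nQ] PQ] := @gfun_continuous _ _ _ sg (p, t) _ nU.
    by exists (Q, P) => // -[t' q] [/= Qt Pq]; exact: (PQ (q, t')).
  by apply: filterS H => q Nq t; exact: Nq.
- move=> [x y] /= xy t; rewrite /diagonal /= in xy; subst y.
  by rewrite /sg segment_diagonal; apply: iU; exists x.
apply/compressible_diagonalP.
(* Over [N] the segments can be retracted into [X]. Their endpoints are images of points of [X],
   where [r] inverts the embedding, so this is a homotopy between the two projections. *)
have sU q : U (gmap_comp sg
    (gmap_prod (gincl hN) (gmap_id (gtriv (unit_interval R)))) q).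
  by case: q => p t; exact: (set_mem (valP p)).
exists (gmap_comp r (gmap_into hU _ sU)) => p; split.
- by apply: rE; rewrite /=; exact: segment0.
- by apply: rE; rewrite /=; exact: segment1.
Qed.

(** * Closedness of the diagonal and the three equalities *)

Lemma diagonal_closed (T : topologicalType) :
  hausdorff_space T -> closed (diagonal : set (T * T)).
Proof.
move=> hT [x y] cxy; apply: hT => P Q nP nQ.
have [|[u v] /= [uv [Pu Qv]]] := cxy (P `*` Q); first by exists (P, Q).
by exists u; split=> //; rewrite /diagonal /= in uv; rewrite uv.
Qed.

Theorem corollary3p12 (R : realType) :
  (forall (G : compactGroupType) (X : gspace G),
     lie_group R G -> compact [set: X] -> ganr R X ->
     TC_sub R X = gcatWh R (diagonal_invariant X)) /\
  (forall T : topologicalType,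
     let X : gspace unit := gtriv T in
     compact [set: T] -> ganr R X ->
     TC R T = gcat R (diagonal : set (gprod X X)) /\
     gcat R (diagonal : set (gprod X X)) =
       gcatWh R (diagonal_invariant X)) /\
  (forall (G : compactGroupType) (X : gspace G),
     lie_group R G -> compact [set: X] -> ganr R X ->
     closed_cofibration R (daleth_invariant X) ->
     TC_sup R X = gcat R (daleth X) /\
     gcat R (daleth X) = gcatWh R (daleth_invariant X)).
Proof.
have TCE (G : compactGroupType) (X : gspace G) :
    TC_sub R X = gcat R (diagonal : set (gprod X X)).
  by congr least; apply/funext => n; apply/propext; exact: TC_sub_gcat.
have cXX (S : topologicalType) : compact [set: S] -> compact [set: S * S].
  by move=> cS; rewrite -setXTT; exact: compact_setX.
have diagE (G : compactGroupType) (X : gspace G) :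
    compact [set: X] -> ganr R X ->
    gcat R (diagonal : set (gprod X X)) = gcatWh R (diagonal_invariant X).
  move=> cX aX; have [N [hN [oN DN cN]]] := ganr_diagonal cX aX.
  have [mX _] := aX.
  apply: (gcat_eq_Wh (diagonal_invariant X) _ _ _ oN DN cN).
  - exact: diagonal_closed (metrizable_hausdorff mX).
  - exact: cXX.
  - exact: metrizable_prod.
split; [|split].
- by move=> G X _ cX aX; rewrite TCE; exact: diagE.
- by move=> T X cT aX; split; [exact: TCE|exact: diagE].
(* The first equality is the definition of [TC_sup]; the neighbourhood for the second comes from the
   cofibration. *)
- move=> G X _ cX [mX _] cof; split=> //.
  have [N [hN [oN AN cN]]] := cofibration_compressible cof.
  have [clA _] := cof.
  apply: (gcat_eq_Wh (daleth_invariant X) clA _ _ oN AN cN).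
  - exact: cXX.
  - exact: metrizable_prod.
Qed.
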